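(* Let $X$ be a represented space, $Y$ a computable metric space and $f:\subseteq X\rightrightarrows Y$ a problem. Then the following are equivalent: (1) $f:\subseteq X\rightrightarrows Y$ is limit computable; (2) $\lim_Y\circ g\sqsubseteq f$ for some computable $g:\subseteq X\rightrightarrows Y^{\mathbb{N}}$.
   Context: $f:\subseteq X\rightrightarrows Y$ denotes a partial multi-valued function (nonempty values on its domain). Composition: $(g\circ f)(x):=\{z:(\exists y\in f(x))\;z\in g(y)\}$ with $\mathrm{dom}(g\circ f):=\{x\in\mathrm{dom}(f):f(x)\subseteq\mathrm{dom}(g)\}$. For $f,s:\subseteq X\rightrightarrows Y$, $s\sqsubseteq f$ means $\mathrm{dom}(f)\subseteq\mathrm{dom}(s)$ and $s(x)\subseteq f(x)$ for all $x\in\mathrm{dom}(f)$. A representation of a set $X$ is a surjective partial function $\delta_X:\subseteq\mathbb{N}^{\mathbb{N}}\to X$; $(X,\delta_X)$ is then a represented space. A problem is a partial multi-valued function between represented spaces. $F:\subseteq\mathbb{N}^{\mathbb{N}}\to\mathbb{N}^{\mathbb{N}}$ is a realizer of $f:\subseteq X\rightrightarrows Y$ if $\delta_YF(p)\in f\delta_X(p)$ for all $p\in\mathrm{dom}(f\delta_X)$. A problem is computable (limit computable) if it has a realizer with that property. A partial function $F:\subseteq\mathbb{N}^{\mathbb{N}}\to\mathbb{N}^{\mathbb{N}}$ is computable if there is a Turing machine (infinite input tape, one-way output tape) that on each $p\in\mathrm{dom}(F)$ produces $F(p)$ in the long run; it is limit computable if there is a Turing machine with a two-way output tape (it may revise its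 output) that on each $p\in\mathrm{dom}(F)$ computes $F(p)$ such that each output position $n$ has, after finitely many steps, the content $F(p)(n)$ and is never changed again. Nothing is required outside $\mathrm{dom}(F)$. A computable metric space $(Y,d,\alpha)$ is a metric space $(Y,d)$ with a dense sequence $\alpha:\mathbb{N}\to Y$ such that $d\circ(\alpha\times\alpha):\mathbb{N}^2\to\mathbb{R}$ is a computable (double) sequence of reals. It is represented by its Cauchy representation $\delta_Y(p):=\lim_{n\to\infty}\alpha p(n)$ with $\mathrm{dom}(\delta_Y)=\{p:(\forall k)(\forall n\geq k)\;d(\alpha p(n),\alpha p(k))<2^{-k}$ and $(\alpha p(n))_n$ converges$\}$. $Y^{\mathbb{N}}$ is represented by $\delta_{Y^{\mathbb{N}}}\langle p_0,p_1,\dots\rangle:=(\delta_Y(p_n))_{n}$, where $\langle p_0,p_1,\dots\rangle\langle n,k\rangle:=p_n(k)$, $\langle n,k\rangle:=\frac12(n+k)(n+k+1)+k$. The limit map is $\lim_Y:\subseteq Y^{\mathbb{N}}\to Y$, $(y_n)_n\mapsto\lim_{n\to\infty}y_n$, defined on convergent sequences. *)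

(* Defs.v *)
From mathcomp Require Import all_boot all_order all_algebra.
From mathcomp Require Import boolp classical_sets reals topology.
From mathcomp Require Import zify.

Set Implicit Arguments.
Unset Strict Implicit.
Unset Printing Implicit Defensive.

Import Order.TTheory GRing.Theory Num.Theory.
Local Open Scope classical_set_scope.
Local Open Scope ring_scope.

(** A partial multi-valued function is given by its graph; its domain consists
    of the points that have at least one value. *)
Definition multimap (X Y : Type) := X -> set Y.

Definition mdom (X Y : Type) (f : multimap X Y) : set X := [set x | f x !=set0].

Definition single_valued (X Y : Type) (f : multimap X Y) : Prop :=
  forall x y y', f x y -> f x y' -> y = y'.

(** The conjunct [f x `<=` mdom g] encodes
    dom (g o f) = {x in dom f : f x is included in dom g}. *)
Definition mcomp (X Y Z : Type) (g : multimap Y Z) (f : multimap X Y) :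
    multimap X Z :=
  fun x => [set z | f x `<=` mdom g /\ exists2 y, f x y & g y z].

Definition refines (X Y : Type) (s f : multimap X Y) : Prop :=
  mdom f `<=` mdom s /\ forall x, mdom f x -> s x `<=` f x.

Definition baire := nat -> nat.

(** On a tape a sequence [p] of natural numbers is spelled as the binary
    sequence 0^(p 0) 1 0^(p 1) 1 0^(p 2) 1 ..., with [true] for the digit 1;
    the digit 1 closing the [n]-th block sits in cell n + p 0 + ... + p n. *)
Definition code (p : baire) (i : nat) : bool :=
  [exists n : 'I_i.+1, i == (n + \sum_(j < n.+1) p j)%N].

Inductive move := mv_left | mv_stay | mv_right.

(** Tapes are infinite to the right only; moving left from cell 0 does
    nothing. *)
Definition shift (m : move) (i : nat) : nat :=
  match m with mv_left => i.-1 | mv_stay => i | mv_right => i.+1 end.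

Record tape (S : Type) := Tape { cell : nat -> S; head : nat }.

Definition tape_read (S : Type) (t : tape S) : S := cell t (head t).

Definition tape_act (S : Type) (a : S * move) (t : tape S) : tape S :=
  Tape (fun i => if i == head t then a.1 else cell t i) (shift a.2 (head t)).

(** A machine has a read-only input tape, finitely many work tapes and an output
    tape, whose cells hold a binary digit or are blank ([None]). There are no
    halting states, since the machines compute forever. *)
Record action (state symbol : finType) (ntapes : nat) := Action {
  act_state : state;
  act_in : move;
  act_work : {ffun 'I_ntapes -> symbol * move};
  act_out : option bool * move
}.

Record turing_machine := TuringMachine {
  tm_state : finType;
  tm_symbol : finType;
  tm_ntapes : nat;
  tm_start : tm_state;
  tm_blank : tm_symbol;
  tm_trans : tm_state -> bool -> {ffun 'I_tm_ntapes -> tm_symbol} ->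
    option bool -> action tm_state tm_symbol tm_ntapes
}.

Record config (M : turing_machine) := Config {
  cf_state : tm_state M;
  cf_in : nat;
  cf_work : 'I_(tm_ntapes M) -> tape (tm_symbol M);
  cf_out : tape (option bool)
}.

Definition tm_init (M : turing_machine) : config M :=
  Config (tm_start M) 0 (fun=> Tape (fun=> tm_blank M) 0)
    (Tape (fun=> None) 0).

Definition tm_step (M : turing_machine) (p : baire) (c : config M) : config M :=
  let a := tm_trans (cf_state c) (code p (cf_in c))
             [ffun k => tape_read (cf_work c k)] (tape_read (cf_out c)) in
  Config (act_state a) (shift (act_in a) (cf_in c))
    (fun k => tape_act (act_work a k) (cf_work c k))
    (tape_act (act_out a) (cf_out c)).

Definition tm_run (M : turing_machine) (p : baire) (t : nat) : config M :=
  iter t (tm_step p) (tm_init M).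

(** The output tape is one-way if every step either leaves it alone or prints a
    digit and moves right, so that no digit is ever revised. *)
Definition one_way (M : turing_machine) : Prop :=
  forall q b w o, let a := act_out (@tm_trans M q b w o) in
    a = (o, mv_stay) \/ exists d : bool, a = (Some d, mv_right).

Definition produces (M : turing_machine) (p q : baire) : Prop :=
  forall i, exists t0, forall t, (t0 <= t)%N ->
    cell (cf_out (tm_run M p t)) i = Some (code q i).

Definition computable_fun (F : multimap baire baire) : Prop :=
  exists2 M, one_way M & forall p q, F p q -> produces M p q.

Definition limit_computable_fun (F : multimap baire baire) : Prop :=
  exists M, forall p q, F p q -> produces M p q.

Record represented_space := RepresentedSpace {
  rs_sort :> Type;
  rs_rep : multimap baire rs_sort;
  rs_rep_single : single_valued rs_rep;
  rs_rep_surj : forall x, exists p, rs_rep p x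
}.

Definition problem (X Y : represented_space) := multimap X Y.

(** Single-valuedness makes [F] a partial function on Baire space; its domain may
    exceed that of the composition of [f] with the representation of [X]. *)
Definition realizer (X Y : represented_space) (F : multimap baire baire)
    (f : problem X Y) : Prop :=
  single_valued F /\
  forall p, mdom (mcomp f (@rs_rep X)) p ->
    exists q y, [/\ F p q, rs_rep q y & mcomp f (@rs_rep X) p y].

Definition computable (X Y : represented_space) (f : problem X Y) : Prop :=
  exists2 F, computable_fun F & realizer F f.

Definition limit_computable (X Y : represented_space) (f : problem X Y) : Prop :=
  exists2 F, limit_computable_fun F & realizer F f.

Definition pairing (n k : nat) : nat := (((n + k) * (n + k + 1))./2 + k)%N.

Definition row (p : baire) (n : nat) : baire := fun k => p (pairing n k).

Definition seq_rep (Y : represented_space) : multimap baire (nat -> Y) :=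
  fun p => [set u | forall n, rs_rep (row p n) (u n)].

Lemma seq_rep_single (Y : represented_space) : single_valued (@seq_rep Y).
Proof.
move=> p u v pu pv; apply/funext => n.
exact: rs_rep_single (pu n) (pv n).
Qed.

Lemma pairing_inj n k n' k' :
  pairing n k = pairing n' k' -> n = n' /\ k = k'.
Proof.
have tri s : ((s * (s + 1))./2 + s.+1 = ((s.+1 * (s.+1 + 1))./2))%N.
  rewrite (_ : s.+1 * (s.+1 + 1) = s * (s + 1) + s.+1.*2)%N; last lia.
  by rewrite halfD oddM addn1 /= odd_double doubleK andbN.
have mono s s' : (s <= s')%N -> ((s * (s + 1))./2 <= (s' * (s' + 1))./2)%N.
  by move=> ss'; apply: half_leq; apply: leq_mul => //; lia.
have half (s s' l l' : nat) : (s < s')%N -> (l <= s)%N ->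
    ((s * (s + 1))./2 + l = (s' * (s' + 1))./2 + l')%N -> False.
  by move=> /mono; rewrite -tri; lia.
rewrite /pairing => e.
have s_eq : (n + k = n' + k')%N.
  case: (ltngtP (n + k) (n' + k')) => // h; exfalso.
    by apply: (half _ _ _ _ h _ e); lia.
  by apply: (half _ _ _ _ h _ (esym e)); lia.
by move: e; rewrite s_eq; lia.
Qed.

Lemma seq_rep_surj (Y : represented_space) (u : nat -> Y) :
  exists p, seq_rep p u.
Proof.
have [P PE] := choice (fun n => rs_rep_surj (u n)).
pose good i (nk : nat * nat) := pairing nk.1 nk.2 = i.
have /choice[dec decE] : forall i, exists nk,
    (exists nk', good i nk') -> good i nk.
  move=> i; by have [[nk ink]|no] := pselect (exists nk, good i nk);
    [exists nk | exists (0, 0)%N].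
exists (fun i => P (dec i).1 (dec i).2) => n.
rewrite (_ : row _ n = P n)//; apply/funext => k; rewrite /row.
have /decE : exists nk, good (pairing n k) nk by exists (n, k).
by move=> /pairing_inj[-> ->].
Qed.

Definition seq_space (Y : represented_space) : represented_space :=
  RepresentedSpace (@seq_rep_single Y) (@seq_rep_surj Y).

(** A point of Baire space is computable if some machine prints it, whatever the
    input. *)
Definition computable_point (h : baire) : Prop :=
  computable_fun (fun=> [set h]).

(** A double sequence of reals is computable if there is a computable triple
    sequence of rationals (-1)^s * a / b approximating it effectively. *)
Definition computable_double_seq (R : realType) (x : nat -> nat -> R) : Prop :=
  exists s a b : baire,
    [/\ computable_point s, computable_point a & computable_point b] /\
    (forall i, b i != 0%N) /\
    forall n m k, let i := pairing (pairing n m) k in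
      `| (-1) ^+ s i * (a i)%:R / (b i)%:R - x n m | <= 2 ^- k.

Record computable_metric_space (R : realType) := ComputableMetricSpace {
  cms_sort :> metricType R;
  cms_alpha : nat -> cms_sort;
  cms_alpha_dense : dense (range cms_alpha);
  cms_computable : computable_double_seq
    (fun n m => mdist (cms_alpha n) (cms_alpha m))
}.

Section CauchySpace.
Variables (R : realType) (Y : computable_metric_space R).

Definition cauchy_rep : multimap baire Y :=
  fun p => [set y |
    (forall k n, (k <= n)%N ->
       mdist (cms_alpha Y (p n)) (cms_alpha Y (p k)) < 2 ^- k) /\
    cms_alpha Y (p n) @[n --> \oo] --> y].

Lemma cauchy_rep_single : single_valued cauchy_rep.
Proof.
move=> p y y' [_ py] [_ py'].
exact: (cvg_unique (@metric_hausdorff R Y) py py').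
Qed.

Lemma cauchy_rep_surj (y : Y) : exists p, cauchy_rep p y.
Proof.
have /choice[p pE] : forall k, exists i, mdist y (cms_alpha Y i) < 2 ^- k.+1.
  move=> k; have k0 : 0 < 2 ^- k.+1 :> R by rewrite invr_gt0 exprn_gt0.
  have [|z [yz [i _ iz]]] := @cms_alpha_dense R Y (ball y (2 ^- k.+1))^° _
    (@open_interior _ _).
    exists y; exact: nbhsx_ballx.
  by exists i; rewrite iz; have := interior_subset yz; rewrite ballEmdist.
have pow_le k n : (k <= n)%N -> 2 ^- n <= 2 ^- k :> R.
  by move=> kn; rewrite lef_pV2 ?posrE ?exprn_gt0// ler_eXn2l// ltr1n.
exists p; split=> [k n kn|].
  apply: (le_lt_trans (metric_triangle _ y _)).
  rewrite metric_sym.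
  have -> : 2 ^- k = 2 ^- k.+1 + 2 ^- k.+1 :> R.
    by rewrite exprSr invfM -splitr.
  by apply: ltrD; [apply: lt_le_trans (pE n) _; apply: pow_le | exact: pE].
apply/metricType_numDomainType.cvgrPdist_lt => e e0.
have [N Ne] : exists N : nat, 2 ^- N < e.
  exists (Num.bound e^-1); rewrite invf_plt ?posrE ?exprn_gt0//.
  exact: upper_nthrootP.
exists N => // n /= Nn.
by apply: (lt_trans (pE n)); apply: le_lt_trans Ne; apply: pow_le; lia.
Qed.

Definition cauchy_space : represented_space :=
  RepresentedSpace cauchy_rep_single cauchy_rep_surj.

Definition lim_map : multimap (nat -> Y) Y :=
  fun u => [set y | u n @[n --> \oo] --> y].

End CauchySpace.

(* Main.v *)
Require Import Defs.
From mathcomp Require Import all_boot all_order all_algebra.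
From mathcomp Require Import boolp classical_sets reals topology.
From mathcomp Require Import zify lra.
(* mathcomp shadows [head] and others. *)
Import Defs.

(** A class of primitive recursive functionals [baire -> nat -> nat] is rich
    enough to simulate any Turing machine for a given number of steps, and each
    of its members can be run by a Turing machine. So a limit machine amounts to
    a functional [V p t n] with limit [q n] as [t] grows, and a one-way machine
    to one that is either right or openly undecided at stage [t]; distances in
    [Y] can be compared with 2^-j, up to a factor 3, in the latter sense.

    From (1) to (2), the stages of a limit computation need not be Cauchy names,
    so stage [t] contributes the constant name of the point [V p t k], where the
    first [k] entries of [V p t] are the ones verified by stage [t] to satisfy
    the Cauchy condition up to that factor: once [V p t N] has settled, the
    contributed points stay within 3 * 2^-N of it.

    From (2) to (1), the [k]-th entry of the name of the limit of [y_n] is taken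
    from the name of [y_n] for the least [n] such that no later [y_m] is found
    too far from [y_n]. Refutations of smaller [n] are found in finite time, so
    the guess settles. *)

Set Implicit Arguments.
Unset Strict Implicit.
Unset Printing Implicit Defensive.

(** * Register programs and Turing machines *)

(** [Bit r] adds the scanned input digit to register [r]; [Out r d m m'] prints
    the digit 1 if register [r] is nonzero, and then moves by [m] if register [d]
    is nonzero and by [m'] otherwise. *)
Inductive instr :=
  Reg of nat & move | Inp of move | Bit of nat | Out of nat & nat & move & move.

Inductive prog :=
  Do of instr | Seq of prog & prog | If of nat & prog & prog | While of nat & prog.

Record store := Store { reg : nat -> nat; ip : nat; out : tape (option bool) }.

(** Registers change by head moves, since each will be realized as a head position; a decrement at 0
    has no effect. *)
Definition reg_move (i : instr) (b : bool) (k : nat) : move :=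
  match i with
  | Reg r m => if k == r then m else mv_stay
  | Bit r => if b && (k == r) then mv_right else mv_stay
  | _ => mv_stay
  end.

Definition in_move (i : instr) : move := if i is Inp m then m else mv_stay.

Definition out_act (i : instr) (z : nat -> bool) (o : option bool) :
    option bool * move :=
  if i is Out r d m m' then (Some (z r), if z d then m else m') else (o, mv_stay).

Definition flags (s : store) (r : nat) : bool := reg s r != 0.

Definition exec (p : baire) (i : instr) (s : store) : store :=
  Store (fun k => shift (reg_move i (code p (ip s)) k) (reg s k))
    (shift (in_move i) (ip s))
    (tape_act (out_act i (flags s) (tape_read (out s))) (out s)).

(** Control points of the flowchart. The extra point [None] of [If] and [While] is where the
    register is tested, under an instruction without effect. *)
Fixpoint node (P : prog) : finType :=
  match P with
  | Do _ => unit
  | Seq P Q => (node P + node Q)%type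
  | If _ P Q => option (node P + node Q)
  | While _ P => option (node P)
  end.

Fixpoint entry (P : prog) : node P :=
  match P with
  | Do _ => tt
  | Seq P _ => inl (entry P)
  | If _ _ _ => None
  | While _ _ => None
  end.

Fixpoint act (P : prog) : node P -> instr :=
  match P with
  | Do i => fun=> i
  | Seq P Q => fun n => match n with inl n => act n | inr n => act n end
  | If _ P Q => fun n =>
      match n with
      | Some (inl n) => act n | Some (inr n) => act n | None => Inp mv_stay
      end
  | While _ P => fun n => if n is Some n then act n else Inp mv_stay
  end.

(** [None] is the exit of the program. *)
Fixpoint next (P : prog) : node P -> (nat -> bool) -> option (node P) :=
  match P with
  | Do _ => fun _ _ => None
  | Seq P Q => fun n z =>
      match n with
      | inl n => Some (if next n z is Some n' then inl n' else inr (entry Q))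
      | inr n => omap inr (next n z)
      end
  | If r P Q => fun n z =>
      match n with
      | None => Some (Some (if z r then inl (entry P) else inr (entry Q)))
      | Some (inl n) => omap (fun n => Some (inl n)) (next n z)
      | Some (inr n) => omap (fun n => Some (inr n)) (next n z)
      end
  | While r P => fun n z =>
      match n with
      | None => if z r then Some (Some (entry P)) else None
      | Some n => Some (next n z)
      end
  end.

(** Only registers tested for zero are counted and get a work tape: the value of any other register
    influences neither control nor output. *)
Definition instr_width (i : instr) : nat :=
  if i is Out r d _ _ then maxn r.+1 d.+1 else 0.

Fixpoint width (P : prog) : nat :=
  match P with
  | Do i => instr_width i
  | Seq P Q => maxn (width P) (width Q)
  | If r P Q => maxn r.+1 (maxn (width P) (width Q))
  | While r P => maxn r.+1 (width P)
  end.

Section Runs.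
Variables (p : baire) (J : tape (option bool) -> Prop).

(** [J] holds of the output tape in all the intermediate stores. *)
Inductive runs_from (P : prog) : option (node P) -> store -> store -> Prop :=
| runs_exit s : J (out s) -> runs_from None s s
| runs_step n s s' : J (out s) ->
    runs_from (next n (flags s)) (exec p (act n) s) s' ->
    runs_from (Some n) s s'.

Definition runs (P : prog) (s s' : store) : Prop := runs_from (Some (entry P)) s s'.

Lemma tape_act_stay S (t : tape S) m :
  tape_act (tape_read t, m) t = Tape (cell t) (shift m (head t)).
Proof.
by rewrite /tape_act; congr Tape; apply/funext => i /=; case: eqP => // ->.
Qed.

Lemma exec_nop s : exec p (Inp mv_stay) s = s.
Proof. by rewrite /exec /= tape_act_stay; case: s => rg i [c h]. Qed.

Lemma runs_from_start P o s s' : @runs_from P o s s' -> J (out s).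
Proof. by case. Qed.

Lemma runs_seq P Q s1 s2 s3 : runs P s1 s2 -> runs Q s2 s3 -> runs (Seq P Q) s1 s3.
Proof.
rewrite /runs /= => PH QH.
have inrH o s : @runs_from Q o s s3 ->
    @runs_from (Seq P Q) (omap inr o) s s3.
  by elim=> [{}s ?|n {}s s' ? _ IH]; [exact: runs_exit | exact: runs_step].
have {}QH := inrH _ _ QH.
have inlH o s s' : @runs_from P o s s' ->
    @runs_from (Seq P Q) (Some (inr (entry Q))) s' s3 ->
    @runs_from (Seq P Q) (Some (if o is Some n then inl n else inr (entry Q))) s s3.
  elim=> [{}s _|n {}s {}s' Js _ IH] H; first exact: H.
  by apply: runs_step => //=; exact: IH.
exact: inlH PH QH.
Qed.

Lemma runs_if r P Q s s' : J (out s) ->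
  (if flags s r then runs P s s' else runs Q s s') -> runs (If r P Q) s s'.
Proof.
move=> Js H; apply: runs_step => //; rewrite [act _]/= exec_nop /=.
have L o t : @runs_from P o t s' ->
    @runs_from (If r P Q) (omap (fun n => Some (inl n)) o) t s'.
  by elim=> [{}t ?|n {}t ? ? _ IH]; [exact: runs_exit | exact: runs_step].
have R o t : @runs_from Q o t s' ->
    @runs_from (If r P Q) (omap (fun n => Some (inr n)) o) t s'.
  by elim=> [{}t ?|n {}t ? ? _ IH]; [exact: runs_exit | exact: runs_step].
by case: ifP H => _; [move/L | move/R].
Qed.

Lemma runs_while_exit r P s : J (out s) -> reg s r = 0 -> runs (While r P) s s.
Proof.
move=> Js s0; apply: runs_step => //; rewrite [act _]/= exec_nop /=.
by rewrite /flags s0; exact: runs_exit.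
Qed.

Lemma runs_while_step r P s1 s2 s3 : reg s1 r != 0 ->
  runs P s1 s2 -> runs (While r P) s2 s3 -> runs (While r P) s1 s3.
Proof.
move=> s1r PH WH; apply: runs_step; first exact: runs_from_start PH.
rewrite [act _]/= exec_nop /= /flags s1r.
have bodyH o s s' : @runs_from P o s s' ->
    @runs_from (While r P) (Some None) s' s3 ->
    @runs_from (While r P) (Some o) s s3.
  elim=> [{}s _|n {}s {}s' Js _ IH] H; first exact: H.
  by apply: runs_step => //=; exact: IH.
exact: bodyH PH WH.
Qed.

(** [S j] is the store after [j] passes; as the tested register holds [n - j], the loop stops after
    exactly [n] passes. *)
Lemma runs_while r P n (S : nat -> store) : J (out (S n)) ->
  (forall j, j <= n -> reg (S j) r = n - j) ->
  (forall j, j < n -> runs P (S j) (S j.+1)) -> runs (While r P) (S 0) (S n).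
Proof.
move=> Jn Sr SP.
suff H m : m <= n -> runs (While r P) (S (n - m)) (S n).
  by have := H n (leqnn n); rewrite subnn.
elim: m => [_|m IH mn].
  by rewrite subn0; apply: runs_while_exit => //; rewrite Sr ?subnn.
apply: (@runs_while_step _ _ _ (S (n - m))); last by apply: IH; lia.
  by rewrite Sr; lia.
by rewrite (_ : n - m = (n - m.+1).+1); [apply: SP; lia | lia].
Qed.

Definition setr (r v : nat) (s : store) : store :=
  Store (fun k => if k == r then v else reg s k) (ip s) (out s).

Lemma runs_inc r s : J (out s) ->
  runs (Do (Reg r mv_right)) s (setr r (reg s r).+1 s).
Proof.
move=> Js; apply: runs_step => //=.
rewrite (_ : exec _ _ _ = setr r (reg s r).+1 s); first exact: runs_exit.
rewrite /exec /setr /= tape_act_stay; case: s {Js} => rg i [c h] /=; congr Store.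
by apply/funext => k; case: eqP => [->|].
Qed.

Lemma runs_dec r s : J (out s) ->
  runs (Do (Reg r mv_left)) s (setr r (reg s r).-1 s).
Proof.
move=> Js; apply: runs_step => //=.
rewrite (_ : exec _ _ _ = setr r (reg s r).-1 s); first exact: runs_exit.
rewrite /exec /setr /= tape_act_stay; case: s {Js} => rg i [c h] /=; congr Store.
by apply/funext => k; case: eqP => [->|].
Qed.

Lemma runs_inp m s : J (out s) ->
  runs (Do (Inp m)) s (Store (reg s) (shift m (ip s)) (out s)).
Proof.
move=> Js; apply: runs_step => //=.
rewrite (_ : exec _ _ _ = Store (reg s) (shift m (ip s)) (out s)); first exact: runs_exit.
by rewrite /exec /= tape_act_stay; case: s {Js} => rg i [c h].
Qed.

Lemma runs_bit r s : J (out s) ->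
  runs (Do (Bit r)) s (setr r (reg s r + code p (ip s)) s).
Proof.
move=> Js; apply: runs_step => //=.
rewrite (_ : exec _ _ _ = setr r (reg s r + code p (ip s)) s); first exact: runs_exit.
rewrite /exec /setr /= tape_act_stay; case: s {Js} => rg i [c h] /=; congr Store.
by apply/funext => k; case: eqP => [->|]; case: (code p i) => //=; lia.
Qed.

Lemma runs_out r d m m' s :
  let o := tape_act (Some (reg s r != 0), if reg s d != 0 then m else m') (out s) in
  J (out s) -> J o -> runs (Do (Out r d m m')) s (Store (reg s) (ip s) o).
Proof.
move=> o Js Jo; apply: runs_step => //=.
by rewrite (_ : exec _ _ _ = Store (reg s) (ip s) o) //; exact: runs_exit.
Qed.

End Runs.

Lemma next_ext P (n : node P) z z' :
  (forall r, r < width P -> z r = z' r) -> next n z = next n z'.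
Proof.
elim: P n => [i|P IP Q IQ|r P IP Q IQ|r P IP] //= n zz'.
- case: n => n; first by rewrite (IP n) // => r rP; apply: zz'; lia.
  by rewrite (IQ n) // => r rP; apply: zz'; lia.
- case: n => [[] n|]; last by rewrite zz' //; lia.
    by rewrite (IP n) // => k kP; apply: zz'; lia.
  by rewrite (IQ n) // => k kP; apply: zz'; lia.
- case: n => [n|]; last by rewrite zz' //; lia.
  by rewrite (IP n) // => k kP; apply: zz'; lia.
Qed.

Lemma out_act_ext P (n : node P) z z' o :
  (forall r, r < width P -> z r = z' r) ->
  out_act (act n) z o = out_act (act n) z' o.
Proof.
elim: P n => [i|P IP Q IQ|r P IP Q IQ|r P IP] //= n zz'.
- by case: i zz' => //= r d m m' zz'; rewrite !zz' //; lia.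
- by case: n => n; [apply: IP | apply: IQ] => r rP; apply: zz'; lia.
- case: n => [[] n|] //; [apply: IP | apply: IQ] => k kP; apply: zz'; lia.
- by case: n => [n|] //; apply: IP => k kP; apply: zz'; lia.
Qed.

(** * Turing machines executing register programs *)

Section Machine.
Variable P : prog.

(** The mark is scanned exactly when the head is on cell 0, that is, when the register is zero. The
    default for indices without a tape is never consulted. *)
Definition nonzero (w : {ffun 'I_(width P) -> bool}) (r : nat) : bool :=
  if insub r is Some k then ~~ w k else false.

(** Register [k] is the head position on work tape [k], whose cell 0 gets marked
    in the first step. The machine repeats [P] forever. *)
Definition machine_trans (q : option (node P)) (b : bool)
    (w : {ffun 'I_(width P) -> bool}) (o : option bool) :=
  match q with
  | None => Action (Some (entry P)) mv_stay [ffun=> (true, mv_stay)] (o, mv_stay)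
  | Some n =>
    Action (Some (odflt (entry P) (next n (nonzero w)))) (in_move (act n))
      [ffun k => (w k, reg_move (act n) b k)] (out_act (act n) (nonzero w) o)
  end.

Definition machine : turing_machine :=
  @TuringMachine (option (node P)) bool (width P) None false machine_trans.

Definition machine_config (s : store) (n : node P) : config machine :=
  @Config machine (Some n) (ip s)
    (fun k => Tape (fun i => i == 0) (reg s k)) (out s).

Definition store0 : store := Store (fun=> 0) 0 (Tape (fun=> None) 0).

Lemma machine_start p :
  tm_step p (tm_init machine) = machine_config store0 (entry P).
Proof.
rewrite /tm_step /machine_config /=; congr Config.
  apply/funext => k; rewrite ffunE /tape_act /=; congr Tape.
  by apply/funext => i; case: eqP.
exact: (tape_act_stay (Tape (fun=> None) 0) mv_stay).
Qed.

Lemma machine_step p s n : tm_step p (machine_config s n) =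
  machine_config (exec p (act n) s) (odflt (entry P) (next n (flags s))).
Proof.
have zE r : r < width P ->
    nonzero [ffun k : 'I_(width P) => reg s k == 0] r = flags s r.
  by move=> rP; rewrite /nonzero insubT ffunE.
rewrite /tm_step /machine_config /= /tape_read /=; congr Config.
- by rewrite (next_ext _ zE).
- apply/funext => k; rewrite !ffunE.
  exact: (tape_act_stay (Tape (fun i => i == 0) (reg s k))).
- by rewrite (out_act_ext _ _ zE).
Qed.

(** An exit leads straight back to the entry, so a run of [P] is one round of the machine. A round
    takes a positive number of steps, so the rounds exhaust time. *)
Lemma machine_runs p J s s' : runs p J P s s' ->
  exists2 m, 0 < m &
    iter m (tm_step p) (machine_config s (entry P)) = machine_config s' (entry P) /\
    forall l, l <= m -> J (cf_out (iter l (tm_step p) (machine_config s (entry P)))).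
Proof.
have aux o t : @runs_from p J P o t s' ->
  exists m, [/\ (0 < m) || ~~ o,
    iter m (tm_step p) (machine_config t (odflt (entry P) o)) =
      machine_config s' (entry P) &
    forall l, l <= m -> 
      J (cf_out (iter l (tm_step p) (machine_config t (odflt (entry P) o))))].
  elim=> [{}t Jt|n {}t t' Jt _ [m [_ mE mJ]]].
    by exists 0; split=> // l; rewrite leqn0 => /eqP ->.
  exists m.+1; split=> //=; first by rewrite -iterS iterSr machine_step.
  by case=> [|l] lm //; rewrite iterSr machine_step; exact: mJ.
by move=> /aux[m [m0 mE mJ]]; exists m; rewrite ?orbF // in m0 *.
Qed.

(** From the start of round [n] on, every configuration lies in some round [n' >= n]. Strong
    induction on the elapsed time strips off one round after the other. *)
Lemma machine_forever p (S : nat -> store) (J : nat -> tape (option bool) -> Prop) :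
  S 0 = store0 -> (forall n, runs p (J n) P (S n) (S n.+1)) ->
  forall n, exists t0, forall t, t0 <= t ->
    exists2 n', n <= n' & J n' (cf_out (tm_run machine p t)).
Proof.
move=> S0 SP.
have reach n : exists t, tm_run machine p t = machine_config (S n) (entry P).
  elim: n => [|n [t tE]]; first by exists 1; rewrite /tm_run /= machine_start S0.
  have [m _ [mE _]] := machine_runs (SP n).
  by exists (m + t); rewrite /tm_run iterD -/(tm_run machine p t) tE.
move=> n; have [t0 t0E] := reach n; exists t0 => t /subnK <-.
move: (t - t0) => {t} d.
elim/ltn_ind: d n t0 t0E => d IH n t tE.
have [m m0 [mE mJ]] := machine_runs (SP n).
have [dm|md] := leqP d m.
  by exists n => //; rewrite /tm_run iterD -/(tm_run machine p t) tE; exact: mJ.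
have [||n' nn' ?] := IH (d - m) _ n.+1 (m + t); first lia.
  by rewrite /tm_run iterD -/(tm_run machine p t) tE.
by exists n'; [exact: ltnW | rewrite (_ : d + t = d - m + (m + t)); last lia].
Qed.

End Machine.

(** The successor in the order of [pairing]: down a diagonal with growing second component, then on
    to the start of the next diagonal. *)
Definition unpair_next (u : nat * nat) : nat * nat :=
  if u.1 is x.+1 then (x, u.2.+1) else (u.2.+1, 0).

Definition unpair (n : nat) : nat * nat := iter n unpair_next (0, 0).
Definition un1 (n : nat) : nat := (unpair n).1.
Definition un2 (n : nat) : nat := (unpair n).2.

Lemma pairing_sum x y : pairing x y = \sum_(i < (x + y).+1) i + y.
Proof.
congr (_ + _); elim: (x + y) => [|n IH]; first by rewrite big_ord_recr big_ord0.
rewrite [RHS]big_ord_recr [in RHS]/= -IH.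
rewrite (_ : n.+1 * _ = n * (n + 1) + n.+1.*2); last lia.
by rewrite halfD oddM addn1 /= odd_double doubleK andbN.
Qed.

Lemma pairing_next u : 
  pairing (unpair_next u).1 (unpair_next u).2 = (pairing u.1 u.2).+1.
Proof.
case: u => [[|x] y]; rewrite !pairing_sum /= ?addn0 ?add0n.
  by rewrite [LHS]big_ord_recr /= addnS.
by rewrite addSn !addnS.
Qed.

Lemma unpairK n : pairing (un1 n) (un2 n) = n.
Proof.
rewrite /un1 /un2; elim: n => [|n IH] //; rewrite -[in RHS]IH -pairing_next.
by rewrite /unpair iterS.
Qed.

Lemma pairingK1 x y : un1 (pairing x y) = x.
Proof. by case: (pairing_inj (unpairK (pairing x y))). Qed.

Lemma pairingK2 x y : un2 (pairing x y) = y.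
Proof. by case: (pairing_inj (unpairK (pairing x y))). Qed.

(** * Register programs for copying, pairing, unpairing and reading the input *)

Definition Inc r := Do (Reg r mv_right).
Definition Dec r := Do (Reg r mv_left).
Definition clear r := While r (Dec r).
Definition move1 r b := While r (Seq (Dec r) (Inc b)).
Definition move2 r b c := While r (Seq (Dec r) (Seq (Inc b) (Inc c))).
Definition copy r b c := Seq (move2 r b c) (move1 c r).
(** From [x] in [r] and [y] in [b], the loop adds [x + y], [x + y - 1], ..., 1 to the [y] kept in
    [b.+1], following [pairing_sum]. *)
Definition pair_prog r b :=
  Seq (move2 b r b.+1)
    (Seq (While r (Seq (copy r b.+1 b.+2) (Dec r))) (move1 b.+1 r)).
Definition unpair_prog r b :=
  While r (Seq (Dec r)
    (If b (Seq (Dec b) (Inc b.+1)) (Seq (Inc b) (move1 b.+1 b)))).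
(** The input head walks to the cell numbered by [r] while [b] records the distance for the way
    back. The digit is added to [r] once it has been counted down to 0. *)
Definition orc_prog r b :=
  Seq (While r (Seq (Dec r) (Seq (Do (Inp mv_right)) (Inc b))))
    (Seq (Do (Bit r)) (While b (Seq (Dec b) (Do (Inp mv_left))))).

Ltac case_regs :=
  repeat match goal with
  | |- context [if ?a == ?b then _ else _] => case: (@eqP _ a b) => ?
  end.
Ltac store_eq :=
  repeat match goal with S := _ : nat -> store |- _ => subst S end;
  simpl in *; rewrite /setr /=; congr Store; try (apply/funext => ? /=);
  case_regs; subst; try (by []); try (by exfalso; lia); try lia.

Section Programs.
Variables (p : baire) (J : tape (option bool) -> Prop).
Local Notation runs := (runs p J).

Lemma runs_eq P s t t' : runs P s t -> t = t' -> runs P s t'.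
Proof. by move=> + <-. Qed.

Lemma runs_loop r P n (S : nat -> store) s s' : S 0 = s -> S n = s' -> J (out s') ->
  (forall j, j <= n -> reg (S j) r = n - j) ->
  (forall j, j < n -> runs P (S j) (S j.+1)) -> runs (While r P) s s'.
Proof. by move=> <- <- *; exact: runs_while. Qed.

Lemma runs_clear r s : J (out s) -> runs (clear r) s (setr r 0 s).
Proof.
move=> Js; pose S j := setr r (reg s r - j) s.
apply: (@runs_loop _ _ (reg s r) S) => //; [by case: s @S Js => *; store_eq..| |].
  by move=> j _; rewrite /= eqxx.
move=> j jn; by apply: runs_eq; [exact: runs_dec | case: s @S Js jn => *; store_eq].
Qed.

Lemma runs_move1 r b s : r != b -> J (out s) ->
  runs (move1 r b) s (setr r 0 (setr b (reg s b + reg s r) s)).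
Proof.
move=> /eqP rb Js; pose S j := setr r (reg s r - j) (setr b (reg s b + j) s).
apply: (@runs_loop _ _ (reg s r) S) => //; [by case: s @S Js => *; store_eq..| |].
  by move=> j _; rewrite /= eqxx.
move=> j jn; apply: runs_eq.
  by apply: runs_seq; [exact: runs_dec | exact: runs_inc].
by case: s @S Js jn => *; store_eq.
Qed.

Lemma runs_move2 r b c s : r != b -> r != c -> b != c -> J (out s) ->
  runs (move2 r b c) s
    (setr r 0 (setr b (reg s b + reg s r) (setr c (reg s c + reg s r) s))).
Proof.
move=> /eqP rb /eqP rc /eqP bc Js.
pose S j := setr r (reg s r - j) (setr b (reg s b + j) (setr c (reg s c + j) s)).
apply: (@runs_loop _ _ (reg s r) S) => //; [by case: s @S Js => *; store_eq..| |].
  by move=> j _; rewrite /= eqxx.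
move=> j jn; apply: runs_eq.
  apply: runs_seq; first exact: runs_dec.
  by apply: runs_seq; exact: runs_inc.
by case: s @S Js jn => *; store_eq.
Qed.

Lemma runs_copy r b c s : r != b -> r != c -> b != c -> J (out s) ->
  reg s c = 0 -> runs (copy r b c) s (setr b (reg s b + reg s r) s).
Proof.
move=> rb rc bc Js sc; apply: runs_eq.
  apply: runs_seq; first exact: runs_move2.
  by apply: runs_move1; rewrite // eq_sym.
move: rb rc bc => /eqP rb /eqP rc /eqP bc.
by case: s Js sc => *; store_eq.
Qed.

Lemma runs_pair_prog r b s : r < b -> J (out s) ->
  reg s b.+1 = 0 -> reg s b.+2 = 0 ->
  runs (pair_prog r b) s (setr r (pairing (reg s r) (reg s b)) (setr b 0 s)).
Proof.
case: s => rg i o /= rb Jo b1 b2.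
set n := rg r + rg b.
pose S j := Store (fun k => if k == r then n - j else
  if k == b then 0 else
  if k == b.+1 then rg b + \sum_(n.+1 - j <= l < n.+1) l else rg k) i o.
apply: runs_eq.
  apply: runs_seq; first by apply: runs_move2 => //; lia.
  apply: (@runs_seq _ _ _ _ _ (S n)); last by apply: runs_move1 => //; lia.
  apply: (@runs_loop _ _ n S) => //.
  - by rewrite /S subn0 big_geq //; store_eq.
  - by move=> j _; rewrite /= eqxx.
  move=> j jn; apply: runs_eq.
    apply: runs_seq; first by apply: runs_copy => //=; case_regs; lia.
    exact: runs_dec.
  have -> : S j.+1 = Store (fun k => if k == r then n - j.+1 else
    if k == b then 0 else if k == b.+1 then
      rg b + (n - j + \sum_(n.+1 - j <= l < n.+1) l) else rg k) i o.
    rewrite /S (_ : n.+1 - j = (n.+1 - j.+1).+1); last lia.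
    by rewrite (big_ltn (m := n.+1 - j.+1)) ?subSS //; lia.
  by store_eq.
rewrite /S pairing_sum -/n (_ : n.+1 - n = 1); last lia.
have -> : \sum_(l < n.+1) l = \sum_(1 <= l < n.+1) l.
  by rewrite -(big_mkord xpredT (fun l => l)) big_ltn.
by store_eq.
Qed.

Lemma runs_unpair_prog r b s : r < b -> J (out s) ->
  reg s b = 0 -> reg s b.+1 = 0 ->
  runs (unpair_prog r b) s
    (setr r 0 (setr b (un1 (reg s r)) (setr b.+1 (un2 (reg s r)) s))).
Proof.
case: s => rg i o /= rb Jo b0 b1.
pose S j := setr r (rg r - j) (setr b (un1 j) (setr b.+1 (un2 j) (Store rg i o))).
apply: (@runs_loop _ _ (rg r) S) => //; [by store_eq..| |].
  by move=> j _; rewrite /= eqxx.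
move=> j jn; have -> : S j.+1 = setr r (rg r - j.+1)
    (setr b (unpair_next (unpair j)).1
      (setr b.+1 (unpair_next (unpair j)).2 (Store rg i o))) by [].
rewrite /S /un1 /un2; case: (unpair j) => x y; rewrite /unpair_next /=.
apply: runs_eq; last reflexivity.
apply: runs_seq; first exact: runs_dec.
apply: runs_if => //; rewrite /flags /=.
rewrite (_ : b == r = false) ?eqxx; last by apply/eqP; lia.
case: x => [|x] /=.
  apply: runs_eq.
    by apply: runs_seq; [exact: runs_inc | apply: runs_move1 => //; lia].
  by store_eq.
apply: runs_eq; first by apply: runs_seq; [exact: runs_dec | exact: runs_inc].
by store_eq.
Qed.

Lemma runs_orc_prog r b s : r < b -> J (out s) -> ip s = 0 -> reg s b = 0 ->
  runs (orc_prog r b) s (setr r (code p (reg s r)) s).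
Proof.
case: s => rg i o /= rb Jo -> {i} b0.
pose S j := setr r (rg r - j) (setr b j (Store rg j o)).
pose S' j := setr r (code p (rg r)) (setr b (rg r - j) (Store rg (rg r - j) o)).
apply: runs_eq.
  apply: runs_seq.
    apply: (@runs_loop _ _ (rg r) S _ (S (rg r))) => //; first by store_eq.
      by move=> j _; rewrite /= eqxx.
    move=> j jn; apply: runs_eq.
      apply: runs_seq; first exact: runs_dec.
      by apply: runs_seq; [exact: runs_inp | exact: runs_inc].
    by store_eq.
  apply: runs_seq; first exact: runs_bit.
  apply: (@runs_loop _ _ (rg r) S' _ (S' (rg r))) => //; first by store_eq.
    by move=> j _; rewrite /=; case_regs; lia.
  move=> j jn; apply: runs_eq.
    by apply: runs_seq; [exact: runs_dec | exact: runs_inp].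
  by store_eq.
by store_eq.
Qed.

End Programs.

(** * Terms for primitive recursive functionals and their compilation *)

Inductive term :=
  | TId | TZero | TSucc | TOrc | TFst | TSnd
  | TComp of term & term | TPair of term & term | TIter of term.

(** The oracle yields digits of the coded input rather than entries of [p], since finding an entry
    takes an unbounded search. Several arguments are passed as nested pairs. *)
Fixpoint eval (p : baire) (t : term) (x : nat) : nat :=
  match t with
  | TId => x
  | TZero => 0
  | TSucc => x.+1
  | TOrc => code p x
  | TFst => un1 x
  | TSnd => un2 x
  | TComp f g => eval p f (eval p g x)
  | TPair f g => pairing (eval p f x) (eval p g x)
  | TIter f => iter (un1 x) (eval p f) (un2 x)
  end.

(** The program replaces the content of register [r]; the registers from [b] on
    are scratch registers, assumed and left to be zero. *)
Fixpoint compile (t : term) (r b : nat) : prog :=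
  match t with
  | TId => Do (Inp mv_stay)
  | TZero => clear r
  | TSucc => Inc r
  | TOrc => orc_prog r b
  | TFst => Seq (unpair_prog r b) (Seq (clear b.+1) (move1 b r))
  | TSnd => Seq (unpair_prog r b) (Seq (clear b) (move1 b.+1 r))
  | TComp f g => Seq (compile g r b) (compile f r b)
  | TPair f g => Seq (copy r b b.+1)
      (Seq (compile f r b.+1) (Seq (compile g b b.+1) (pair_prog r b)))
  | TIter f => Seq (unpair_prog r b)
      (Seq (move1 b.+1 r) (While b (Seq (Dec b) (compile f r b.+1))))
  end.

Lemma runs_compile p J t r b s : r < b -> J (out s) -> ip s = 0 ->
  (forall k, b <= k -> reg s k = 0) ->
  runs p J (compile t r b) s (setr r (eval p t (reg s r)) s).
Proof.
elim: t r b s => [||||||f IHf g IHg|f IHf g IHg|f IHf] r b [rg i o] /= rb Jo i0 s0;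
  have b0 := s0 b (leqnn b); have b1 := s0 b.+1 (leqnSn b).
- by apply: runs_eq; [exact: runs_inp | store_eq].
- exact: runs_clear.
- exact: runs_inc.
- exact: runs_orc_prog.
- apply: runs_eq.
    apply: runs_seq; first exact: runs_unpair_prog.
    by apply: runs_seq; [exact: runs_clear | apply: runs_move1 => //; lia].
  by store_eq.
- apply: runs_eq.
    apply: runs_seq; first exact: runs_unpair_prog.
    by apply: runs_seq; [exact: runs_clear | apply: runs_move1 => //; lia].
  by store_eq.
- apply: runs_eq.
    apply: runs_seq; first exact: IHg.
    by apply: IHf => //= k bk; case_regs; [lia | exact: s0].
  by store_eq.
- apply: runs_eq.
    apply: runs_seq; first by apply: runs_copy => //=; lia.
    apply: runs_seq.
      by apply: IHf => //= [|k bk]; [lia | case_regs; [lia | apply: s0; lia]].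
    apply: runs_seq.
      by apply: IHg => //= k bk; case_regs; try lia; apply: s0; lia.
    by apply: runs_pair_prog => //=; case_regs; try lia; apply: s0; lia.
  by store_eq; rewrite ?b0.
pose S j := setr b (un1 (rg r) - j)
  (setr r (iter j (eval p f) (un2 (rg r))) (Store rg i o)).
apply: runs_eq.
  apply: runs_seq; first exact: runs_unpair_prog.
  apply: runs_seq; first by apply: runs_move1 => //; lia.
  apply: (@runs_loop _ _ _ _ (un1 (rg r)) S _ (S (un1 (rg r)))) => //.
  - by store_eq.
  - by move=> j _; rewrite /= eqxx.
  move=> j jn; apply: runs_eq.
    apply: runs_seq; first exact: runs_dec.
    by apply: IHf => //= [|k bk]; [lia | case_regs; try lia; apply: s0; lia].
  by store_eq.
by store_eq.
Qed.

(** * Primitive recursive functionals *)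

Definition prim (F : baire -> nat -> nat) : Prop :=
  exists t, forall p x, eval p t x = F p x.

Definition prim2 (F : baire -> nat -> nat -> nat) : Prop :=
  prim (fun p w => F p (un1 w) (un2 w)).

Definition prim3 (F : baire -> nat -> nat -> nat -> nat) : Prop :=
  prim (fun p w => F p (un1 w) (un1 (un2 w)) (un2 (un2 w))).

Lemma prim_ext F G : (forall p x, F p x = G p x) -> prim F -> prim G.
Proof. by move=> FG [t tF]; exists t => p x; rewrite tF. Qed.

Lemma prim_id : prim (fun _ x => x).
Proof. by exists TId. Qed.

Lemma prim_comp F G : prim F -> prim G -> prim (fun p x => F p (G p x)).
Proof. by move=> [t tF] [u uG]; exists (TComp t u) => p x /=; rewrite uG tF. Qed.

Lemma prim_succ F : prim F -> prim (fun p x => (F p x).+1).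
Proof. by move=> [t tF]; exists (TComp TSucc t) => p x /=; rewrite tF. Qed.

Lemma prim_const c : prim (fun _ _ => c).
Proof.
by elim: c => [|c]; [exists TZero | move=> H; exact: prim_succ].
Qed.

Lemma prim_code F : prim F -> prim (fun p x => code p (F p x)).
Proof. by move=> [t tF]; exists (TComp TOrc t) => p x /=; rewrite tF. Qed.

Lemma prim_un1 F : prim F -> prim (fun p x => un1 (F p x)).
Proof. by move=> [t tF]; exists (TComp TFst t) => p x /=; rewrite tF. Qed.

Lemma prim_un2 F : prim F -> prim (fun p x => un2 (F p x)).
Proof. by move=> [t tF]; exists (TComp TSnd t) => p x /=; rewrite tF. Qed.

Lemma prim_pairing F G : prim F -> prim G -> prim (fun p x => pairing (F p x) (G p x)).
Proof. by move=> [t tF] [u uG]; exists (TPair t u) => p x /=; rewrite uG tF. Qed.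

Lemma prim_comp2 F A B : prim2 F -> prim A -> prim B ->
  prim (fun p x => F p (A p x) (B p x)).
Proof.
move=> HF HA HB; apply: prim_ext (prim_comp HF (prim_pairing HA HB)) => p x.
by rewrite pairingK1 pairingK2.
Qed.

Lemma prim_comp3 F A B C : prim3 F -> prim A -> prim B -> prim C ->
  prim (fun p x => F p (A p x) (B p x) (C p x)).
Proof.
move=> HF HA HB HC.
apply: prim_ext (prim_comp HF (prim_pairing HA (prim_pairing HB HC))) => p x.
by rewrite !(pairingK1, pairingK2).
Qed.

Lemma prim_iter F N Z : prim F -> prim N -> prim Z ->
  prim (fun p x => iter (N p x) (F p) (Z p x)).
Proof.
move=> [t tF] [n nN] [z zZ]; exists (TComp (TIter t) (TPair n z)) => p x /=.
by rewrite pairingK1 pairingK2 nN zZ; exact: eq_iter.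
Qed.

Lemma prim_iteri N Z s : prim N -> prim Z ->
  prim (fun p w => s p (un1 (un1 w)) (un2 (un1 w)) (un2 w)) ->
  prim (fun p x => iteri (N p x) (fun i a => s p i a x) (Z p x)).
Proof.
move=> HN HZ Hs.
(* Plain iteration knows neither its counter nor a parameter, so the state carries the counter, the
   accumulator and the argument. *)
pose F p w := pairing (pairing (un1 (un1 w)).+1
  (s p (un1 (un1 w)) (un2 (un1 w)) (un2 w))) (un2 w).
have HF : prim F.
  do 2?apply: prim_pairing => //; last exact: prim_un2 prim_id.
  by apply: prim_succ; do 2!apply: prim_un1; exact: prim_id.
have iterF p n x z : iter n (F p) (pairing (pairing 0 z) x) =
    pairing (pairing n (iteri n (fun i a => s p i a x) z)) x.
  by elim: n => //= n ->; rewrite /F !(pairingK1, pairingK2).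
have := prim_iter HF HN (prim_pairing (prim_pairing (prim_const 0) HZ) prim_id).
move=> /prim_un1/prim_un2; apply: prim_ext => p x.
by rewrite iterF pairingK1 pairingK2.
Qed.

Lemma prim_add F G : prim F -> prim G -> prim (fun p x => F p x + G p x).
Proof.
move=> HF HG; have := prim_iter (prim_succ prim_id) HF HG.
by apply: prim_ext => p x; rewrite iter_succn addnC.
Qed.

Lemma prim_pred F : prim F -> prim (fun p x => (F p x).-1).
Proof.
move=> HF; have := @prim_iteri _ _ (fun _ i _ _ => i) HF (prim_const 0)
  (prim_un1 (prim_un1 prim_id)).
by apply: prim_ext => p x; case: (F p x).
Qed.

Lemma prim_sub F G : prim F -> prim G -> prim (fun p x => F p x - G p x).
Proof.
move=> HF HG; have := prim_iter (prim_pred prim_id) HG HF.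
apply: prim_ext => p x; elim: (G p x) => [|n /= ->]; first by rewrite subn0.
by rewrite subnS.
Qed.

Lemma prim_mul F G : prim F -> prim G -> prim (fun p x => F p x * G p x).
Proof.
move=> HF HG; have := @prim_iteri _ _ (fun p _ a x => a + G p x) HF (prim_const 0)
  (prim_add (prim_un2 (prim_un1 prim_id)) (prim_comp HG (prim_un2 prim_id))).
apply: prim_ext => p x; elim: (F p x) => //= n ->.
by rewrite mulSn addnC.
Qed.

Lemma prim_exp2 F : prim F -> prim (fun p x => 2 ^ F p x).
Proof.
move=> HF; have := prim_iter (prim_mul (prim_const 2) prim_id) HF (prim_const 1).
by apply: prim_ext => p x; elim: (F p x) => //= n ->; rewrite expnS.
Qed.

Lemma prim_eq0 F : prim F -> prim (fun p x => F p x == 0).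
Proof.
move=> HF; have := prim_iter (prim_const 0) HF (prim_const 1).
by apply: prim_ext => p x; case: (F p x).
Qed.

Lemma prim_leq F G : prim F -> prim G -> prim (fun p x => F p x <= G p x).
Proof. by move=> HF HG; apply: prim_eq0; exact: prim_sub. Qed.

Lemma prim_neg (b : baire -> nat -> bool) :
  prim (fun p x => b p x) -> prim (fun p x => ~~ b p x).
Proof. by move/prim_eq0; apply: prim_ext => p x; case: (b p x). Qed.

Lemma prim_and (b c : baire -> nat -> bool) :
  prim (fun p x => b p x) -> prim (fun p x => c p x) ->
  prim (fun p x => b p x && c p x).
Proof.
move=> Hb Hc; have := prim_mul Hb Hc.
by apply: prim_ext => p x; rewrite mulnb.
Qed.

Lemma prim_eq F G : prim F -> prim G -> prim (fun p x => F p x == G p x).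
Proof.
move=> HF HG; have := prim_and (prim_leq HF HG) (prim_leq HG HF).
by apply: prim_ext => p x; rewrite eqn_leq.
Qed.

Lemma prim_if (b : baire -> nat -> bool) F G :
  prim (fun p x => b p x) -> prim F -> prim G ->
  prim (fun p x => if b p x then F p x else G p x).
Proof.
move=> Hb HF HG.
have := prim_add (prim_mul Hb HF) (prim_mul (prim_neg Hb) HG).
apply: prim_ext => p x.
by case: (b p x) => /=; rewrite mul1n mul0n ?addn0 ?add0n.
Qed.

Lemma prim_or (b c : baire -> nat -> bool) :
  prim (fun p x => b p x) -> prim (fun p x => c p x) ->
  prim (fun p x => b p x || c p x).
Proof.
move=> Hb Hc; have := prim_if Hb (prim_const 1) Hc.
by apply: prim_ext => p x; case: (b p x).
Qed.

Lemma prim_odd F : prim F -> prim (fun p x => odd (F p x)).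
Proof.
move=> HF; have := prim_iter (prim_eq0 prim_id) HF (prim_const 0).
apply: prim_ext => p x; elim: (F p x) => //= n ->.
by case: (odd n).
Qed.

Lemma prim_find (b : baire -> nat -> nat -> bool) N :
  prim2 (fun p i x => b p i x) -> prim N ->
  prim (fun p x => find (fun i => b p i x) (iota 0 (N p x))).
Proof.
move=> Hb HN.
(* The accumulator equals the counter as long as the search has failed; after the first success it
   stays behind for good. *)
pose step p i a x := if (a == i) && ~~ b p i x then i.+1 else a.
have /(@prim_iteri _ _ step HN (prim_const 0)) : prim (fun p w =>
    if (un2 (un1 w) == un1 (un1 w)) && ~~ b p (un1 (un1 w)) (un2 w)
    then (un1 (un1 w)).+1 else un2 (un1 w)).
  have Hi := prim_un1 (prim_un1 prim_id); have Ha := prim_un2 (prim_un1 prim_id).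
  apply: prim_if => //; last exact: prim_succ.
  apply: prim_and; first exact: prim_eq.
  by apply: prim_neg; apply: (prim_comp2 Hb) => //; exact: prim_un2 prim_id.
apply: prim_ext => p x; elim: (N p x) => // n IH; rewrite [LHS]/= IH /step.
rewrite -[in RHS]addn1 iotaD find_cat size_iota add0n has_find size_iota /=.
have := find_size (fun i => b p i x) (iota 0 n); rewrite size_iota leq_eqVlt.
move=> /orP[/eqP ->|fn]; last by rewrite fn ltn_eqF.
by rewrite eqxx ltnn /=; case: (b p n x); rewrite /= ?addn0 ?addn1.
Qed.

Lemma prim_has (b : baire -> nat -> nat -> bool) N :
  prim2 (fun p i x => b p i x) -> prim N ->
  prim (fun p x => has (fun i => b p i x) (iota 0 (N p x))).
Proof.
move=> Hb HN; have := prim_leq (prim_succ (prim_find Hb HN)) HN.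
by apply: prim_ext => p x; rewrite has_find size_iota.
Qed.

Lemma prim_sum F N : prim2 F -> prim N ->
  prim (fun p x => \sum_(i < N p x) F p i x).
Proof.
move=> HF HN.
have /(@prim_iteri _ _ (fun p i a x => a + F p i x) HN (prim_const 0)) :
    prim (fun p w => un2 (un1 w) + F p (un1 (un1 w)) (un2 w)).
  apply: prim_add; first exact: prim_un2 (prim_un1 prim_id).
  apply: (prim_comp2 HF); first exact: prim_un1 (prim_un1 prim_id).
  exact: prim_un2 prim_id.
apply: prim_ext => p x; elim: (N p x) => [|n /= ->]; first by rewrite big_ord0.
by rewrite big_ord_recr.
Qed.

Ltac prim_tac :=
  rewrite ?/prim2 ?/prim3;
  repeat match goal with
  | |- prim (fun p x => x) => exact: prim_id
  | |- prim (fun=> un1) => exact: prim_un1 prim_id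
  | |- prim (fun=> un2) => exact: prim_un2 prim_id
  | |- prim (fun p x => ?c) => exact: (prim_const c)
  | |- prim (fun p x => un1 (@?F p x)) => apply: (@prim_un1 F)
  | |- prim (fun p x => un2 (@?F p x)) => apply: (@prim_un2 F)
  | |- prim (fun p x => pairing (@?F p x) (@?G p x)) => apply: (@prim_pairing F G)
  | |- prim (fun p x => nat_of_bool (code p (@?F p x))) => apply: (@prim_code F)
  | |- prim (fun p x => nat_of_bool (odd (@?F p x))) => apply: (@prim_odd F)
  | |- prim (fun p x => nat_of_bool (~~ (@?F p x))) => apply: (@prim_neg F)
  | |- prim (fun p x => nat_of_bool ((@?F p x) && (@?G p x))) => apply: (@prim_and F G)
  | |- prim (fun p x => nat_of_bool ((@?F p x) || (@?G p x))) => apply: (@prim_or F G)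
  | |- prim (fun p x => nat_of_bool (leq (@?F p x) (@?G p x))) => apply: (@prim_leq F G)
  | |- prim (fun p x => nat_of_bool (eq_op (@?F p x) (@?G p x))) => apply: (@prim_eq F G)
  | |- prim (fun p x => nat_of_bool (has (@?b p x) (iota 0 (@?N p x)))) =>
      refine (@prim_has (fun p i x => b p x i) N _ _); rewrite ?/prim2; cbv beta
  | |- prim (fun p x => find (@?b p x) (iota 0 (@?N p x))) =>
      refine (@prim_find (fun p i x => b p x i) N _ _); rewrite ?/prim2; cbv beta
  | |- prim (fun p x => addn (@?F p x) (@?G p x)) => apply: (@prim_add F G)
  | |- prim (fun p x => subn (@?F p x) (@?G p x)) => apply: (@prim_sub F G)
  | |- prim (fun p x => muln (@?F p x) (@?G p x)) => apply: (@prim_mul F G)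
  | |- prim (fun p x => expn 2 (@?F p x)) => apply: (@prim_exp2 F)
  | |- prim (fun p x => predn (@?F p x)) => apply: (@prim_pred F)
  | H : prim3 (fun=> ?F) |- prim (fun p x => ?F (@?A p x) (@?B p x) (@?C p x)) =>
      refine (@prim_comp3 (fun=> F) A B C H _ _ _)
  | H : prim2 (fun=> ?F) |- prim (fun p x => ?F (@?A p x) (@?B p x)) =>
      refine (@prim_comp2 (fun=> F) A B H _ _)
  | H : prim (fun=> ?F) |- prim (fun p x => ?F (@?A p x)) =>
      refine (@prim_comp (fun=> F) A H _)
  | H : prim3 ?F |- prim (fun p x => ?F p (@?A p x) (@?B p x) (@?C p x)) =>
      apply: (@prim_comp3 F A B C H)
  | H : prim2 ?F |- prim (fun p x => ?F p (@?A p x) (@?B p x)) =>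
      apply: (@prim_comp2 F A B H)
  | H : prim ?F |- prim (fun p x => ?F p (@?A p x)) => apply: (@prim_comp F A H)
  | |- prim (fun p x => S (@?F p x)) => apply: (@prim_succ F)
  | |- prim ?F =>
      lazymatch eval cbv beta in (F (fun=> 0) 0) with
      | (if _ then _ else _) => apply: prim_if
      end
  end.

Lemma code_has p i : code p i =
  has (fun n => i == n + \sum_(j < n.+1) p j) (iota 0 i.+1).
Proof.
apply/existsP/hasP => -[n]; first by exists (val n); rewrite ?mem_iota ?ltn_ord.
by rewrite mem_iota => ni iE; exists (Ordinal (n := i.+1) (m := n) ni).
Qed.

Lemma prim_code_of Q : prim2 Q -> prim2 (fun p t i => code (Q p t) i).
Proof.
move=> HQ.
suff : prim2 (fun p t i =>
    has (fun n => i == n + \sum_(j < n.+1) Q p t j) (iota 0 i.+1)).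
  by apply: prim_ext => p w; rewrite code_has.
prim_tac; apply: (@prim_sum (fun p j w => Q p (un1 (un2 w)) j)); prim_tac.
Qed.

(** * Printing machines *)

Fixpoint all_instr (Q : instr -> bool) (P : prog) : bool :=
  match P with
  | Do i => Q i
  | Seq P R => all_instr Q P && all_instr Q R
  | If _ P R => all_instr Q P && all_instr Q R
  | While _ P => all_instr Q P
  end.

Lemma all_instr_act (Q : instr -> bool) P (n : node P) :
  Q (Inp mv_stay) -> all_instr Q P -> Q (act n).
Proof.
move=> Q0; elim: P n => [i|P IP R IR|r P IP R IR|r P IP] n //=.
- by case: n => n /andP[QP QR]; [exact: IP | exact: IR].
- by case: n => [[] n|] // /andP[QP QR]; [exact: IP | exact: IR].
- by case: n => [n|] //; exact: IP.
Qed.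

Definition prints_right (i : instr) : bool :=
  match i with
  | Out _ _ mv_right mv_right => true
  | Out _ _ _ _ => false
  | _ => true
  end.

Lemma compile_prints_right t r b : all_instr prints_right (compile t r b).
Proof.
by elim: t r b => //= f IHf g IHg r b; rewrite IHg IHf.
Qed.

Lemma machine_one_way P : all_instr prints_right P -> one_way (machine P).
Proof.
move=> HP [n|] b w o /=; last by left.
have := all_instr_act n (isT : prints_right (Inp mv_stay)) HP.
case: (act n) => [r k _|k _|r _|r d k k'] /=; [by left..|].
by case: k k' => // -[] // _; right; exists (nonzero w r); case: (nonzero w d).
Qed.

(** In round [n] the program prints the digit [eval p f n] and then makes the
    move [m] or [m'] according to [eval p d n]. *)
Definition print_prog (f d : term) (m m' : move) : prog :=
  Seq (copy 0 1 3) (Seq (compile f 1 3)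
    (Seq (copy 0 2 3) (Seq (compile d 2 3)
      (Seq (Do (Out 1 2 m m')) (Seq (clear 1) (Seq (clear 2) (Inc 0))))))).

Section Print.
Variables (f d : term) (m m' : move) (p : baire).

Fixpoint print_tape (n : nat) : tape (option bool) :=
  if n is n'.+1 then
    tape_act (Some (eval p f n' != 0), if eval p d n' != 0 then m else m')
      (print_tape n')
  else Tape (fun=> None) 0.

Definition print_store (n : nat) : store :=
  Store (fun k => if k == 0 then n else 0) 0 (print_tape n).

(** A round executes a single [Out], so only the tapes before and after it occur. *)
Lemma runs_print n :
  runs p (fun t => t = print_tape n \/ t = print_tape n.+1)
    (print_prog f d m m') (print_store n) (print_store n.+1).
Proof.
have Jn : out (print_store n) = print_tape n \/
    out (print_store n) = print_tape n.+1 by left.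
apply: runs_eq.
  apply: runs_seq; first exact: runs_copy.
  apply: runs_seq.
    by apply: runs_compile => // -[|[|[|k]]].
  apply: runs_seq; first exact: runs_copy.
  apply: runs_seq.
    by apply: runs_compile => // -[|[|[|k]]].
  apply: runs_seq; first by apply: runs_out => //; right.
  apply: runs_seq; first by apply: runs_clear; right.
  apply: runs_seq; first by apply: runs_clear; right.
  by apply: runs_inc; right.
rewrite /setr /print_store /=; congr Store.
by apply/funext => k /=; case_regs; lia.
Qed.

Lemma print_machine i b n0 :
  (forall n, n0 <= n -> cell (print_tape n) i = b) ->
  exists t0, forall t, t0 <= t ->
    cell (cf_out (tm_run (machine (print_prog f d m m')) p t)) i = b.
Proof.
move=> nE.
have S0 : print_store 0 = store0.
  by rewrite /print_store /store0; congr Store; apply/funext => -[].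
have [t0 t0E] := machine_forever S0 runs_print n0.
exists t0 => t /t0E[n n0n [] ->]; apply: nE => //; exact: leqW.
Qed.

End Print.

Lemma prim_prints B : prim B ->
  exists2 M, one_way M &
    forall p q, (forall i, code q i = (B p i != 0)) -> produces M p q.
Proof.
move=> [f fB]; exists (machine (print_prog f f mv_right mv_right)).
  by apply: machine_one_way; rewrite /= !compile_prints_right.
move=> p q qB i; apply: (@print_machine _ _ _ _ _ _ _ i.+1) => n.
have tE : print_tape f f mv_right mv_right p n =
    Tape (fun i => if i < n then Some (B p i != 0) else None) n.
  elim: n => //= n ->; rewrite /tape_act /=; congr Tape.
    apply/funext => k; rewrite fB ltnS [k <= n]leq_eqVlt.
    by case: eqP => [->|].
  by case: (_ != 0).
by rewrite tE /= => ->; rewrite qB.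
Qed.

(** The head of the limit machine sweeps from 0 to [s] and back for ever larger
    [s]; the sweep to the left is one step longer, which cell 0 absorbs. *)
Definition sweep_right (n : nat) : bool := odd (un1 n + un2 n).
Definition sweep_pos (n : nat) : nat := if sweep_right n then un2 n else un1 n.

Lemma sweep_posS n :
  sweep_pos n.+1 = shift (if sweep_right n then mv_right else mv_left) (sweep_pos n).
Proof.
rewrite /sweep_pos /sweep_right /un1 /un2.
have -> : unpair n.+1 = unpair_next (unpair n) by [].
case: (unpair n) => -[|x] y; rewrite /unpair_next /= ?addn0 ?add0n.
  by rewrite /=; case: (odd y).
by rewrite addnS /=; case: (odd (x + y)).
Qed.

(** Round [n] writes the stage [n] value for the cell under the head. Every cell is visited at
    arbitrarily late stages, and all visits after the value has settled write the right digit. *)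
Lemma prim_prints_limit B : prim2 B ->
  exists M, forall p q,
    (forall i, exists t0, forall t, t0 <= t -> (B p t i != 0) = code q i) ->
    produces M p q.
Proof.
move=> HB.
have [f fB] : prim (fun p n => B p n
    (if odd (un1 n + un2 n) then un2 n else un1 n)) by prim_tac.
have [d dE] : prim (fun _ n => odd (un1 n + un2 n)) by prim_tac.
exists (machine (print_prog f d mv_right mv_left)) => p q Bq i.
have {}fB n : eval p f n = B p n (sweep_pos n) by rewrite fB.
have {}dE n : (eval p d n != 0) = sweep_right n.
  by rewrite dE /sweep_right; case: (odd _).
have [t0 t0B] := Bq i.
have [n1 n1t0 n1i] : exists2 n1, t0 <= n1 & sweep_pos n1 = i.
  (* The odd diagonal [2 s + 1] is a sweep to the right and meets cell [i] when the second component
     is [i]; the index of this pair is at least [2 s + 1], hence at least [t0]. *)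
  pose s := t0 + i; exists (pairing ((s + s).+1 - i) i).
    rewrite pairing_sum.
    rewrite (_ : (s + s).+1 - i + i = (s + s).+1); last by rewrite /s; lia.
    by rewrite big_ord_recr /= /s; lia.
  rewrite /sweep_pos /sweep_right pairingK1 pairingK2.
  rewrite (_ : (s + s).+1 - i + i = (s + s).+1); last by rewrite /s; lia.
  by rewrite /= oddD addbb.
apply: (@print_machine _ _ _ _ _ _ _ n1.+1) => n n1n.
have headE k : head (print_tape f d mv_right mv_left p k) = sweep_pos k.
  by elim: k => //= k ->; rewrite sweep_posS dE.
rewrite -(subnK n1n); elim: (n - n1.+1) => [|k IH] /=.
  rewrite headE n1i eqxx fB n1i; congr Some; exact: t0B.
rewrite headE fB; case: eqP => [iE|_]; last exact: IH.
by congr Some; rewrite -iE; apply: t0B; lia.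
Qed.

(** * Simulation of Turing machines *)

(** A number codes the sequence of its iterated components; 0 codes the zero
    sequence. *)
Definition get (i x : nat) : nat := un1 (iter i un2 x).
Definition mk (l : seq nat) : nat := foldr pairing 0 l.
Definition put (i w x : nat) : nat :=
  iteri i (fun j a => pairing (get (i - j.+1) x) a) (pairing w (iter i.+1 un2 x)).

Lemma getS i x : get i.+1 x = get i (un2 x).
Proof. by rewrite /get iterSr. Qed.

Lemma get_iter i n x : get i (iter n un2 x) = get (i + n) x.
Proof. by rewrite /get -iterD. Qed.

Lemma get_mk i l : get i (mk l) = nth 0 l i.
Proof.
elim: l i => [|a l IH] i.
  rewrite nth_nil /get /=; suff -> : iter i un2 0 = 0 by [].
  by elim: i => //= i ->.
case: i => [|i]; first by rewrite /get /= pairingK1.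
by rewrite getS /= pairingK2; exact: IH.
Qed.

Lemma get_put i w x k : get k (put i w x) = if k == i then w else get k x.
Proof.
(* After [j] steps of rebuilding, the first [i - j] components of [x] are still missing in front,
   whence the shift of indices. *)
suff H j : j <= i -> forall k,
    get k (iteri j (fun j a => pairing (get (i - j.+1) x) a)
                   (pairing w (iter i.+1 un2 x))) =
    if k == j then w else get (k + (i - j)) x.
  by rewrite /put H // subnn addn0.
elim: j => [|j IH] ji [|{}k] /=.
- by rewrite /get /= pairingK1.
- by rewrite getS pairingK2 -/(iter i.+1 un2 x) get_iter subn0 addSnnS.
- by rewrite {1}/get /= pairingK1 add0n.
- rewrite getS pairingK2 IH ?(ltnW ji) //.
  by rewrite eqSS addSnnS subnSK.
Qed.

Lemma prim_get : prim2 (fun _ => get).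
Proof.
apply: prim_un1; apply: (@prim_iter (fun _ => un2)); last exact: prim_un2 prim_id.
  exact: prim_un2 prim_id.
exact: prim_un1 prim_id.
Qed.

Lemma prim_put : prim3 (fun _ => put).
Proof.
pose s (p : baire) i a x := pairing (get (un1 x - i.+1) (un2 (un2 x))) a.
have G := prim_get.
pose Z (p : baire) w := pairing (un1 (un2 w)) (iter (un1 w).+1 un2 (un2 (un2 w))).
apply: (@prim_iteri (fun _ => un1) Z s); rewrite /s /Z; prim_tac.
by apply: (@prim_iter (fun=> un2) (fun _ w => (un1 w).+1)); prim_tac.
Qed.

Lemma prim_mk T (l : seq T) F : (forall a, prim (F a)) ->
  prim (fun p x => mk [seq F a p x | a <- l]).
Proof.
move=> HF; elim: l => [|a l IH]; first exact: prim_const.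
exact: prim_pairing.
Qed.

(** A function on a finite type is a finite case distinction on codes. This covers the transition
    table of a machine. *)
Lemma prim_table (A : finType) (e v : A -> nat) : injective e ->
  exists2 h : nat -> nat, prim (fun _ => h) & forall a, h (e a) = v a.
Proof.
move=> einj.
pose h l z := foldr (fun a r => if z == e a then v a else r) 0 l.
exists (h (enum A)).
  elim: (enum A) => [|a l IH] /=; first exact: prim_const.
  by apply: prim_if => //; prim_tac.
move=> a; have : a \in enum A by rewrite mem_enum.
elim: (enum A) => //= b l IH; rewrite inE (inj_eq einj).
by case: eqP => [->|_] //= /IH.
Qed.

(** Chosen so that moving means adding the code and subtracting 1, where truncation handles cell
    0. *)
Definition code_move (m : move) : nat :=
  match m with mv_left => 0 | mv_stay => 1 | mv_right => 2 end.

Lemma shiftE m i : shift m i = i + code_move m - 1.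
Proof. by case: m => /=; lia. Qed.

(** The element [a] gets code 0, so the number 0, as the zero sequence, codes a tape filled with
    [a]. *)
Definition code_in (T : finType) (a b : T) : nat := index b (a :: enum T).

Lemma code_in_inj (T : finType) (a : T) : injective (code_in a).
Proof.
move=> b c /(congr1 (nth a (a :: enum T))).
by rewrite !nth_index // inE mem_enum orbT.
Qed.

Definition tape_coded S (cd : S -> nat) (x : nat) (t : tape S) : Prop :=
  un2 x = head t /\ forall i, get i (un1 x) = cd (cell t i).

Lemma tape_coded_read S (cd : S -> nat) x t :
  tape_coded cd x t -> get (un2 x) (un1 x) = cd (tape_read t).
Proof. by move=> [-> xE]; rewrite xE. Qed.

Lemma tape_coded_act S (cd : S -> nat) x t a : tape_coded cd x t ->
  tape_coded cd
    (pairing (put (un2 x) (cd a.1) (un1 x)) (un2 x + code_move a.2 - 1))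
    (tape_act a t).
Proof.
move=> [hE xE]; split; first by rewrite pairingK2 hE /= shiftE.
by move=> i; rewrite pairingK1 get_put hE xE /=; case: eqP.
Qed.

Section Simulation.
Variable M : turing_machine.
Let K := tm_ntapes M.
Let code_state := code_in (tm_start M).
Let code_symbol := code_in (tm_blank M).
Let code_out := code_in (None : option bool).
Let scan_type : finType :=
  (tm_state M * bool * {ffun 'I_K -> tm_symbol M} * option bool)%type.
Let ks := enum 'I_K.

Let code_scan (a : scan_type) : nat :=
  mk [:: code_state a.1.1.1, (a.1.1.2 : nat), code_out a.2 &
      [seq code_symbol (a.1.2 k) | k <- ks]].

Let get_mk3 a b c (F : 'I_K -> nat) (k : 'I_K) :
  get (3 + k) (mk [:: a, b, c & [seq F k | k <- ks]]) = F k.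
Proof.
by rewrite get_mk /= add0n (nth_map k) /ks ?nth_ord_enum ?size_enum_ord.
Qed.

Let code_scan_inj : injective code_scan.
Proof.
move=> [[[q b] w] o] [[[q' b'] w'] o'] /= E.
have get_eq j := congr1 (get j) E.
have := get_eq 0; have := get_eq 1; have := get_eq 2.
rewrite !get_mk /= => /code_in_inj -> bb /code_in_inj ->.
have -> : w = w'.
  by apply/ffunP => k; have := get_eq (3 + k); rewrite !get_mk3 => /code_in_inj.
by congr (_, _, _, _); case: b b' bb {E get_eq} => -[].
Qed.

Let config_coded (x : nat) (c : config M) : Prop :=
  [/\ get 0 x = code_state (cf_state c), get 1 x = cf_in c,
      tape_coded code_out (get 2 x) (cf_out c) &
      forall k : 'I_K, tape_coded code_symbol (get (3 + k) x) (cf_work c k)].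

Let scan (p : baire) (x : nat) : nat :=
  mk [:: get 0 x, (code p (get 1 x) : nat),
         get (un2 (get 2 x)) (un1 (get 2 x)) &
      [seq get (un2 (get (3 + k) x)) (un1 (get (3 + k) x)) | k : 'I_K <- ks]].

Let scanE p x c : config_coded x c ->
  scan p x = code_scan (cf_state c, code p (cf_in c),
             [ffun k => tape_read (cf_work c k)], tape_read (cf_out c)).
Proof.
move=> [qE iE oE wE]; rewrite /scan /code_scan /= qE iE (tape_coded_read oE).
congr (mk [:: _, _, _ & _]); apply: eq_map => k.
by rewrite ffunE (tape_coded_read (wE k)).
Qed.

Let prim_scan : prim scan.
Proof.
have G := prim_get; rewrite /scan; do 3![apply: prim_pairing; first by prim_tac].
by apply: (@prim_mk _ ks (fun (k : 'I_K) p x =>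
  get (un2 (get (3 + k) x)) (un1 (get (3 + k) x)))) => k; prim_tac.
Qed.

(** One step looks up the scanned symbols in finite tables and updates the coded tapes; a run of [t]
    steps is an iteration. *)
Lemma prim_simulation : exists2 C, prim2 C &
  forall p t i, C p t i = code_in None (cell (cf_out (tm_run M p t)) i).
Proof.
pose tr (a : scan_type) := tm_trans a.1.1.1 a.1.1.2 a.1.2 a.2.
pose table v := @prim_table scan_type code_scan v code_scan_inj.
have [hq Hq hqE] := table (fun a => code_state (act_state (tr a))).
have [hi Hi hiE] := table (fun a => code_move (act_in (tr a))).
have [ho Ho hoE] := table (fun a => code_out (act_out (tr a)).1).
have [hm Hm hmE] := table (fun a => code_move (act_out (tr a)).2).
have /choice[hw /all_and2[Hw hwE]] : forall k, exists h : nat -> nat,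
    prim (fun _ => h) /\ forall a, h (code_scan a) = code_symbol (act_work (tr a) k).1.
  by move=> k; have [h] := table (fun a => code_symbol (act_work (tr a) k).1); exists h.
have /choice[hn /all_and2[Hn hnE]] : forall k, exists h : nat -> nat,
    prim (fun _ => h) /\ forall a, h (code_scan a) = code_move (act_work (tr a) k).2.
  by move=> k; have [h] := table (fun a => code_move (act_work (tr a) k).2); exists h.
pose upd w m x := pairing (put (un2 x) w (un1 x)) (un2 x + m - 1).
pose step p x := mk [:: hq (scan p x), get 1 x + hi (scan p x) - 1,
  upd (ho (scan p x)) (hm (scan p x)) (get 2 x) &
  [seq upd (hw k (scan p x)) (hn k (scan p x)) (get (3 + k) x) | k : 'I_K <- ks]].
have G := prim_get; have P := prim_put; have Sc := prim_scan.
have Hstep : prim step.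
  rewrite /step /upd; do 3![apply: prim_pairing; first by prim_tac].
  apply: (@prim_mk _ ks (fun (k : 'I_K) p x => pairing
    (put (un2 (get (3 + k) x)) (hw k (scan p x)) (un1 (get (3 + k) x)))
    (un2 (get (3 + k) x) + hn k (scan p x) - 1))) => k.
  by have Hwk := Hw k; have Hnk := Hn k; prim_tac.
have stepE p x c : config_coded x c -> config_coded (step p x) (tm_step p c).
  move=> cx; have [_ iE oE wE] := cx; rewrite /step (scanE p cx) hqE hiE hoE hmE.
  split.
  - by rewrite get_mk.
  - by rewrite get_mk /= iE shiftE.
  - by rewrite get_mk; exact: tape_coded_act.
  - move=> k; rewrite get_mk3 hwE hnE; exact: tape_coded_act.
(* The missing components read as 0, which stands for heads on cell 0 and blank tapes. *)
pose x0 := mk [:: code_state (tm_start M)].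
have runE p t : config_coded (iter t (step p) x0) (tm_run M p t).
  elim: t => [|t IH]; last exact: stepE.
  have blank S (cd : S -> nat) b : cd b = 0 -> tape_coded cd 0 (Tape (fun=> b) 0).
    move=> b0; split=> // i /=; rewrite b0.
    by have := get_mk i [::]; rewrite nth_nil.
  split; rewrite ?get_mk //=; first exact: blank.
  move=> k; rewrite get_mk nth_default //; apply: blank.
  by rewrite /code_symbol /code_in /= eqxx.
exists (fun p t i => get i (un1 (get 2 (iter t (step p) x0)))).
  by rewrite /prim2; have Hrun := prim_iter Hstep (prim_un1 prim_id) (prim_const x0);
    apply: (prim_comp2 G); prim_tac; exact: Hrun.
by move=> p t i; have [_ _ [_ ->] _] := runE p t.
Qed.

End Simulation.

(** * Reading the output tape *)

Definition block_start (q : baire) (n : nat) : nat := n + \sum_(j < n) q j.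

Lemma block_startS q n : block_start q n.+1 = (block_start q n + q n).+1.
Proof. by rewrite /block_start big_ord_recr /=; lia. Qed.

Lemma block_start_mono q m n : m <= n -> block_start q m <= block_start q n.
Proof.
move=> /subnK <-; elim: (n - m) => // k; rewrite addSn block_startS; lia.
Qed.

Lemma codeE q i : reflect (exists n, i = block_start q n + q n) (code q i).
Proof.
rewrite code_has; apply: (iffP hasP) => -[n].
  by move=> _ /eqP ->; exists n; rewrite /block_start big_ord_recr /=; lia.
move=> iE; exists n; first by rewrite mem_iota iE /block_start; lia.
by rewrite iE /block_start big_ord_recr /=; apply/eqP; lia.
Qed.

Lemma code_block_end q n : code q (block_start q n + q n).
Proof. by apply/codeE; exists n. Qed.

Lemma code_block q n k : k < q n -> code q (block_start q n + k) = false.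
Proof.
move=> kn; apply/codeE => -[m]; have [mn|nm] := ltnP m n.
  by have := block_start_mono q mn; rewrite block_startS; lia.
move: nm; rewrite leq_eqVlt => /orP[/eqP <-|nm]; first lia.
by have := block_start_mono q nm; rewrite block_startS; lia.
Qed.

Lemma code_ext q q' i : (forall j, j <= i -> q j = q' j) -> code q i = code q' i.
Proof.
move=> qq'; rewrite !code_has; apply: eq_in_has => n; rewrite mem_iota => ni.
by congr (_ == _ + _); apply: eq_bigr => j _; apply: qq'; have := ltn_ord j; lia.
Qed.

(** [run w L s] is the length of the block of zeros starting in cell [s]; blocks
    longer than [L] are cut off. *)
Definition run (w : nat -> bool) (L s : nat) : nat :=
  find (fun k => w (s + k)) (iota 0 L).

Definition start (w : nat -> bool) (L n : nat) : nat :=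
  iter n (fun s => (s + run w L s).+1) 0.

Lemma find_iota (b : pred nat) n L :
  n < L -> b n -> (forall i, i < n -> ~~ b i) -> find b (iota 0 L) = n.
Proof.
move=> nL bn bi; have hb : has b (iota 0 L).
  by apply/hasP; exists n => //; rewrite mem_iota.
have fL : find b (iota 0 L) < L by move: hb; rewrite has_find size_iota.
have := nth_find 0 hb; rewrite nth_iota // add0n => bf.
case: (ltngtP (find b (iota 0 L)) n) => // [fn|nf]; first by have := bi _ fn; rewrite bf.
by have := before_find 0 nf; rewrite nth_iota ?add0n ?bn.
Qed.

Lemma run_startE (w : nat -> bool) q L n :
  (forall i, i <= block_start q n + q n -> w i = code q i) ->
  block_start q n + q n < L ->
  start w L n = block_start q n /\ run w L (start w L n) = q n.
Proof.
have runE m : (forall i, i <= block_start q m + q m -> w i = code q i) ->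
    block_start q m + q m < L -> run w L (block_start q m) = q m.
  move=> wq qL; apply: find_iota; [lia|by rewrite wq ?code_block_end|].
  by move=> i iq; rewrite wq ?code_block //; lia.
move=> wq qL; suff sE : start w L n = block_start q n by rewrite sE runE.
elim: n wq qL => [|n IH] wq qL; first by rewrite /block_start big_ord0.
have sn := block_startS q n.
have wn i : i <= block_start q n + q n -> w i = code q i by move=> ?; apply: wq; lia.
have nL : block_start q n + q n < L by lia.
by rewrite /start iterS -/(start w L n) IH // runE.
Qed.

Lemma start_mono w L m n : m <= n ->
  start w L m + run w L (start w L m) <= start w L n + run w L (start w L n).
Proof.
elim: n => [|n IH]; first by rewrite leqn0 => /eqP ->.
rewrite leq_eqVlt => /orP[/eqP ->//|/IH].
by rewrite /start iterS -/(start w L n); lia.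
Qed.

(** If the parsed end [c] came before the true end of block [n], consider the least block [m] that
    truly ends after [c]. Its start is parsed correctly and its parsed end is at most [c], so a
    digit 1 would lie among the zeros of that block. *)
Lemma run_start_sound (w : nat -> bool) q L n c :
  c = start w L n + run w L (start w L n) -> c < L -> w c ->
  (forall i, i <= c -> w i = code q i) -> run w L (start w L n) = q n.
Proof.
move=> cE cL wc wq; have [le_c|c_lt] := leqP (block_start q n + q n) c.
  by apply: (run_startE (w := w) _ _).2 => [i ic|]; [apply: wq|]; lia.
exfalso; have ex : exists m, c < block_start q m + q m by exists n.
case: (ex_minnP ex) => m cm m_min.
have mn := m_min _ c_lt; have := start_mono w L mn; rewrite -cE.
have sE : start w L m = block_start q m.
  case: m {cm mn} m_min => [|m] m_min; first by rewrite /block_start big_ord0.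
  have mc : block_start q m + q m <= c.
    by rewrite leqNgt; apply/negP => /m_min; rewrite ltnn.
  have [||sm rm] := @run_startE w q L m; [by move=> i im; apply: wq; lia|lia|].
  by rewrite /start iterS -/(start w L m) rm sm block_startS.
rewrite sE => le_c; have kL : run w L (block_start q m) < L by lia.
have hk : has (fun k => w (block_start q m + k)) (iota 0 L).
  by rewrite has_find size_iota.
have := nth_find 0 hk; rewrite nth_iota // add0n -/(run w L _) wq // code_block //.
lia.
Qed.

Lemma code_inj : injective code.
Proof.
move=> q q' qq'; apply/funext => n.
pose L := (block_start q n + q n + (block_start q' n + q' n)).+1.
have [||_ <-] := @run_startE (code q) q L n; [by []|rewrite /L; lia|].
by have [||_ <-] := @run_startE (code q') q' L n; [by []|rewrite /L; lia|rewrite qq'].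
Qed.

Lemma prim_run C (c : nat) : prim2 C ->
  prim3 (fun p t L s => run (fun i => C p t i == c) L s).
Proof. by move=> HC; rewrite /run; prim_tac. Qed.

Lemma prim_start C (c : nat) : prim2 C ->
  prim2 (fun p t n => start (fun i => C p t i == c) t n).
Proof.
move=> HC; have Hrun := @prim_run C c HC.
have H : prim2 (fun p s t => (s + run (fun i => C p t i == c) t s).+1).
  apply: prim_succ; apply: prim_add; first exact: prim_un1 prim_id.
  by apply: (prim_comp3 Hrun); prim_tac.
pose s (p : baire) (i a w : nat) := (a + run (fun i => C p (un1 w) i == c) (un1 w) a).+1.
have [|||t tE] := @prim_iteri (fun=> un2) (fun _ _ => 0) s.
- exact: prim_un2 prim_id.
- exact: prim_const.
- by rewrite /s; apply: (prim_comp2 H); prim_tac.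
exists t => p w; rewrite tE /start; by elim: (un2 w) => //= n ->.
Qed.

(** The stage value 0 means undecided, and a decided value is shifted by 1. A decided value is
    always right, so it can be acted upon at once. *)
Definition approximates (v : nat -> nat -> nat) (h : nat -> nat) : Prop :=
  (forall t n, v t n != 0 -> v t n = (h n).+1) /\
  forall n, exists t0, forall t, t0 <= t -> v t n != 0.

Lemma approximates_eventually v h n : approximates v h ->
  exists t0, forall t, t0 <= t -> v t n = (h n).+1.
Proof. by move=> [vh /(_ n)[t0 t0v]]; exists t0 => t /t0v /vh. Qed.

Lemma eventually_all (P : nat -> nat -> Prop) n :
  (forall k, k < n -> exists t0, forall t, t0 <= t -> P k t) ->
  exists t0, forall t, t0 <= t -> forall k, k < n -> P k t.
Proof.
elim: n => [|n IH] nP; first by exists 0.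
have [|t1 t1P] := IH; first by move=> k kn; apply: nP; lia.
have [//|t2 t2P] := nP n; exists (maxn t1 t2) => t tt k; rewrite ltnS leq_eqVlt.
by move=> /orP[/eqP ->|]; [apply: t2P | apply: t1P]; lia.
Qed.

(** A digit is printed only together with a move to the right past it, so the head separates the
    printed cells from the blank ones. *)
Lemma one_way_out M p t i : one_way M ->
  (head (cf_out (tm_run M p t)) <= i) = (cell (cf_out (tm_run M p t)) i == None).
Proof.
move=> M1; elim: t i => [|t IH] i //.
rewrite /tm_run iterS -/(tm_run M p t) /tm_step; set c := tm_run M p t in IH *.
have := M1 (cf_state c) (code p (cf_in c)) [ffun k => tape_read (cf_work c k)]
  (tape_read (cf_out c)).
move=> /= [->|[d ->]] /=; last first.
  case: (i =P head (cf_out c)) => [->|/eqP iN]; first by rewrite ltnn.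
  by rewrite -IH ltn_neqAle eq_sym iN.
case: (i =P head (cf_out c)) => [->|_]; last exact: IH.
by rewrite leqnn /tape_read -IH leqnn.
Qed.

Lemma one_way_keep M p t t' i : one_way M -> t <= t' ->
  cell (cf_out (tm_run M p t)) i != None ->
  cell (cf_out (tm_run M p t')) i = cell (cf_out (tm_run M p t)) i.
Proof.
move=> M1 /subnK <-; elim: (t' - t) => // k IH iN; rewrite -[in RHS](IH iN).
have : cell (cf_out (tm_run M p (k + t))) i != None by rewrite IH.
rewrite -(one_way_out p _ i M1) -ltnNge addSn {2}/tm_run iterS -/(tm_run M p _).
rewrite /tm_step; set c := tm_run M p _ => ic.
by have := M1 (cf_state c) (code p (cf_in c)) [ffun k => tape_read (cf_work c k)]
  (tape_read (cf_out c)) => /= -[->|[d ->]] /=; rewrite (ltn_eqF ic).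
Qed.

(** All cells before a printed one are printed too, and printed cells keep their digits, which must
    therefore be the final ones. *)
Lemma one_way_prefix M p q t c : one_way M -> produces M p q ->
  cell (cf_out (tm_run M p t)) c != None ->
  forall i, i <= c -> cell (cf_out (tm_run M p t)) i = Some (code q i).
Proof.
move=> M1 Mq cN i ic; have [t0 t0E] := Mq i.
have iN : cell (cf_out (tm_run M p t)) i != None.
  move: cN; rewrite -!(one_way_out p t _ M1) -!ltnNge; exact: leq_ltn_trans.
rewrite -(t0E (maxn t0 t)) ?leq_maxl //; apply/esym; apply: one_way_keep => //.
exact: leq_maxr.
Qed.

Lemma one_way_approx M : one_way M -> exists2 V, prim2 V &
  forall p q, produces M p q -> approximates (V p) q.
Proof.
move=> M1; have [C HC CE] := prim_simulation M.
pose c1 := code_in (None : option bool) (Some true).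
pose w p t i := C p t i == c1.
(* A block counts as decided when its parsed end lies before the cut-off [t] and carries the digit
   1; all cells up to there are then printed, hence final. *)
pose V p t n := if (start (w p t) t n + run (w p t) t (start (w p t) t n) < t) &&
  (C p t (start (w p t) t n + run (w p t) t (start (w p t) t n)) == c1)
  then (run (w p t) t (start (w p t) t n)).+1 else 0.
have Hstart := prim_start c1 HC.
have Hrun : prim2 (fun p t n => run (w p t) t (start (w p t) t n)).
  by apply: (prim_comp3 (prim_run c1 HC)); prim_tac.
exists V.
  rewrite /V /prim2; apply: prim_if; last exact: prim_const.
    apply: prim_and; last first.
      apply: prim_eq; last exact: prim_const.
      apply: (prim_comp2 HC); first exact: prim_un1 prim_id.
      exact: prim_add.
    apply: prim_leq; last exact: prim_un1 prim_id.
    by apply: prim_succ; exact: prim_add.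
  exact: prim_succ.
have wE p t i : w p t i = (cell (cf_out (tm_run M p t)) i == Some true).
  by rewrite /w CE (inj_eq (@code_in_inj _ _)).
move=> p q Mq; split.
  move=> t n; rewrite /V; case: ifP => // /andP[cL wc] _; congr S.
  move: cL wc; set c := start _ _ _ + _ => cL wc.
  apply: (run_start_sound (c := c)) => // i ic; rewrite wE.
  rewrite (one_way_prefix M1 Mq _ ic) //.
  by move: wc; rewrite -/(w p t c) wE => /eqP ->.
move=> n; set e := block_start q n + q n.
have [|t0 t0E] := @eventually_all (fun i t =>
    cell (cf_out (tm_run M p t)) i = Some (code q i)) e.+1; first by move=> k _.
exists (maxn t0 e.+1) => t tt.
have wq i : i <= e -> w p t i = code q i.
  by move=> ie; rewrite wE (t0E t _ i ie); [case: (code q i)|lia].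
have [|sE rE] := @run_startE (w p t) q t n wq; first lia.
rewrite /V rE sE -/e -/(w p t e) wq // code_block_end andbT.
by have -> : e < t by lia.
Qed.

(** The tape may be revised, so the parsed value is returned untested. It is right once all cells up
    to the end of block [n] have settled and the cut-off exceeds that end. *)
Lemma limit_approx M : exists2 V, prim2 V &
  forall p q, produces M p q ->
    forall n, exists t0, forall t, t0 <= t -> V p t n = q n.
Proof.
have [C HC CE] := prim_simulation M.
pose c1 := code_in (None : option bool) (Some true).
pose w p t i := C p t i == c1.
exists (fun p t n => run (w p t) t (start (w p t) t n)).
  have Hstart := prim_start c1 HC.
  by apply: (prim_comp3 (prim_run c1 HC)); prim_tac.
have wE p t i : w p t i = (cell (cf_out (tm_run M p t)) i == Some true).
  by rewrite /w CE (inj_eq (@code_in_inj _ _)).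
move=> p q Mq n; set e := block_start q n + q n.
have [|t0 t0E] := @eventually_all (fun i t =>
    cell (cf_out (tm_run M p t)) i = Some (code q i)) e.+1; first by move=> k _.
exists (maxn t0 e.+1) => t tt.
have wq i : i <= e -> w p t i = code q i.
  by move=> ie; rewrite wE (t0E t _ i ie); [case: (code q i)|lia].
by have [|_ ->] := @run_startE (w p t) q t n wq; first lia.
Qed.

Lemma produces_inj M p q q' : produces M p q -> produces M p q' -> q = q'.
Proof.
move=> Mq Mq'; apply: code_inj; apply/funext => i.
have [t tE] := Mq i; have [t' tE'] := Mq' i.
have := tE (maxn t t') (leq_maxl _ _); rewrite tE' ?leq_maxr // => -[].
by [].
Qed.

(** * Limits in computable metric spaces *)

Import Order.TTheory GRing.Theory Num.Theory.
Local Open Scope classical_set_scope.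
Local Open Scope ring_scope.

Section Metric.
Variables (R : realType) (Y : computable_metric_space R).
Local Notation alpha := (cms_alpha Y).

Lemma cvg_mdistP (u : nat -> Y) (y : Y) : u n @[n --> \oo] --> y <->
  forall e : R, 0 < e -> exists N, forall n, (N <= n)%N -> mdist y (u n) < e.
Proof.
split=> [/metricType_numDomainType.cvgrPdist_lt uy e /uy[N _ NP]|uy].
  by exists N => n; exact: NP.
apply/metricType_numDomainType.cvgrPdist_lt => e /uy[N NP].
by exists N => // n; exact: NP.
Qed.

Lemma exp2V_gt0 k : 0 < 2 ^- k :> R.
Proof. by rewrite invr_gt0 exprn_gt0. Qed.

Lemma exp2VS k : 2 ^- k = 2 ^- k.+1 + 2 ^- k.+1 :> R.
Proof. by rewrite exprSr invfM -splitr. Qed.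

(** Expresses powers in a common unit with numeral factors, for use by linear arithmetic. *)
Lemma exp2V_split k m : 2 ^- k = (2 ^ m)%:R * 2 ^- (k + m) :> R.
Proof.
by rewrite exprD natrX invfM mulrCA divff ?mulr1 // expf_neq0 // pnatr_eq0.
Qed.

Lemma exp2V_le k n : (k <= n)%N -> 2 ^- n <= 2 ^- k :> R.
Proof. by move=> kn; rewrite lef_pV2 ?posrE ?exprn_gt0// ler_eXn2l// ltr1n. Qed.

Lemma exp2V_lt (e : R) : 0 < e -> exists n : nat, 2 ^- n < e.
Proof.
move=> e0; exists (Num.bound e^-1); rewrite invf_plt ?posrE ?exprn_gt0//.
exact: upper_nthrootP.
Qed.

Lemma cauchy_rep_dist p (y : Y) k :
  cauchy_rep p y -> mdist y (alpha (p k)) <= 2 ^- k.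
Proof.
move=> [pk /cvg_mdistP py]; apply/ler_addgt0Pr => e /py[N NP].
have := NP _ (leq_maxl N k); have := pk _ _ (leq_maxr N k).
by have := metric_triangle y (alpha (p (maxn N k))) (alpha (p k)); lra.
Qed.

Lemma cauchy_rep_const a : cauchy_rep (fun=> a) (alpha a).
Proof.
split=> [k n _|]; first by rewrite mdistxx exp2V_gt0.
by apply/cvg_mdistP => e e0; exists 0%N => n _; rewrite mdistxx.
Qed.

(** A rational within [2 ^- j] of the distance is compared with [2 * 2 ^- j]; the error widens this
    threshold to the bounds [3 * 2 ^- j] and [2 ^- j]. *)
Lemma dist_test : exists (close : nat -> bool) chi,
  [/\ prim2 chi, forall p, approximates (chi p) close &
    forall n m j, if close (pairing (pairing n m) j)
      then mdist (alpha n) (alpha m) < 3 * 2 ^- j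
      else 2 ^- j <= mdist (alpha n) (alpha m)].
Proof.
have [s [a [b [[cs ca cb] [b0 dE]]]]] := cms_computable Y.
have approx h : computable_point h -> exists2 V, prim2 V &
    forall p, approximates (V p) h.
  move=> [M /one_way_approx[V HV VE] Mh]; exists V => // p; apply: VE.
  exact: Mh.
have [Vs Hs VsE] := approx _ cs; have [Va Ha VaE] := approx _ ca.
have [Vb Hb VbE] := approx _ cb.
(* With a negative sign the rational is at most 0, so the distance is at most [2 ^- j]; otherwise
   the comparison is made with denominators cleared. Here [un2 x] is the precision [j]. *)
pose close x := odd (s x) || (a x * 2 ^ un2 x < 2 * b x)%N.
(* The answers are 0 for undecided, 1 for far and 2 for close. *)
pose chi p t x := if [&& Vs p t x != 0, Va p t x != 0 & Vb p t x != 0]%N then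
  (odd (Vs p t x).-1 || ((Va p t x).-1 * 2 ^ un2 x < 2 * (Vb p t x).-1)%N).+1
  else 0%N.
exists close, chi; split.
- by rewrite /chi /prim2; prim_tac.
- move=> p; split=> [t x|x].
    rewrite /chi; case: ifP => // /and3P[/(proj1 (VsE p)) -> /(proj1 (VaE p)) ->].
    by move=> /(proj1 (VbE p)) ->.
  have [[_ /(_ x)[t1 t1P]] [_ /(_ x)[t2 t2P]] [_ /(_ x)[t3 t3P]]] :=
    And3 (VsE p) (VaE p) (VbE p).
  exists (maxn t1 (maxn t2 t3)) => t tt; rewrite /chi t1P ?t2P ?t3P //; lia.
move=> n m j; have := dE n m j; set i := pairing (pairing n m) j => /=.
have e0 := exp2V_gt0 j.
have E0 : 0 < 2 ^+ j :> R by rewrite exprn_gt0.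
have bi : 0 < (b i)%:R :> R by rewrite ltr0n lt0n.
have ai : 0 <= (a i)%:R / (b i)%:R :> R by rewrite divr_ge0.
rewrite /close ler_norml => /andP[lo hi].
have sE : (-1) ^+ s i = if odd (s i) then -1 else 1 :> R.
  by rewrite -signr_odd; case: (odd (s i)).
case: (boolP (odd (s i))) sE lo hi => /= _ ->; first lra.
have -> : un2 i = j by rewrite pairingK2.
have ltE : (a i * 2 ^ j < 2 * b i)%N = ((a i)%:R / (b i)%:R < 2 * 2 ^- j :> R).
  rewrite ltr_pdivrMr // -(ltr_nat R) !natrM natrX mulrAC.
  by rewrite ltr_pdivlMr.
by rewrite ltE; case: ltP => ?; lra.
Qed.

End Metric.

(** * From limit names to convergent sequences, and back *)

Section Limits.
Variables (R : realType) (Y : computable_metric_space R).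
Local Notation alpha := (cms_alpha Y).

Lemma limit_name_sequence V : prim2 V -> exists2 a, prim a &
  forall p q (y : Y),
    (forall n, exists t0, forall t, (t0 <= t)%N -> V p t n = q n) ->
    cauchy_rep q y -> alpha (a p t) @[t --> \oo] --> y.
Proof.
move=> HV; have [close [chi [Hchi chiE closeE]]] := dist_test Y.
pose idx p t k j := pairing (pairing (V p t k.+1) (V p t j)) j.
(* The least [k] below [t] such that entry [k + 1] is not yet found close to all entries up to [k],
   or [t] if there is none. So entry [K p t] itself has passed against all earlier entries. *)
pose K p t := find (fun k => has (fun j => chi p t (idx p t k j) != 2%N)
  (iota 0 k.+1)) (iota 0 t).
have HK : prim K by rewrite /K /idx; prim_tac.
exists (fun p t => V p t (K p t)); first by prim_tac.
move=> p q y Vq qy; apply/cvg_mdistP => e e0.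
(* Entry [N] is within [2 ^- N] of [y] and the chosen point within [3 * 2 ^- N] of entry [N];
   together this is 4 times [2 ^- N]. *)
have [N Ne] : exists N : nat, 2 ^- N < e / 4 by apply: exp2V_lt; lra.
have q_eventually : exists t0, forall t, (t0 <= t)%N ->
    forall n, (n < N.+2)%N -> V p t n = q n.
  by apply: eventually_all => n _; exact: Vq.
(* Entries of a Cauchy name are less than [2 ^- j] apart, which excludes the answer far, so the test
   settles on 2. *)
have chi_eventually : exists t0, forall t, (t0 <= t)%N ->
    forall k, (k < N.+1)%N -> forall j, (j < k.+1)%N ->
    chi p t (pairing (pairing (q k.+1) (q j)) j) = 2%N.
  apply: eventually_all => k _; apply: eventually_all => j jk.
  have [t0 t0E] := approximates_eventually
    (pairing (pairing (q k.+1) (q j)) j) (chiE p).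
  exists t0 => t /t0E ->; have := closeE (q k.+1) (q j) j; case: (close _) => //.
  by have := qy.1 j k.+1 (ltnW jk) => lt_d le_d; exfalso; lra.
have [[t1 t1E] [t2 t2E]] := (q_eventually, chi_eventually).
exists (maxn t1 (maxn t2 N.+2)) => t tt.
have NK : (N < K p t)%N.
  rewrite ltnNge; apply/negP => KN.
  have hK : (K p t < size (iota 0 t))%N by rewrite size_iota; lia.
  move: (hK); rewrite -has_find => /(nth_find 0%N); rewrite nth_iota ?add0n; last first.
    by rewrite size_iota in hK.
  rewrite -/(K p t) => /hasP[j]; rewrite mem_iota => jK.
  by rewrite /idx !t1E ?t2E //; lia.
have [k kE] : exists k, K p t = k.+1 by exists (K p t).-1; lia.
have kt : (k < t)%N.
  have := find_size (fun k => has (fun j => chi p t (idx p t k j) != 2%N)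
    (iota 0 k.+1)) (iota 0 t).
  by rewrite size_iota -/(K p t); lia.
(* The index [k] before [K p t] passed the search; its test at [j = N] compares entry [K p t] with
   entry [N]. *)
have /negbT : has (fun j => chi p t (idx p t k j) != 2%N) (iota 0 k.+1) = false.
  have := @before_find _ 0%N (fun k => has (fun j => chi p t (idx p t k j) != 2%N)
    (iota 0 k.+1)) (iota 0 t) k; rewrite nth_iota // add0n; apply.
  by rewrite -/(K p t) kE.
move=> /hasPn/(_ N); rewrite mem_iota negbK /idx (t1E t _ N) ?leqnn //; last lia.
rewrite -kE => H.
have {H} /eqP chi2 := H ltac:(by apply/andP; split; lia).
have := (chiE p).1 t (pairing (pairing (V p t (K p t)) (q N)) N); rewrite chi2.
move=> /(_ isT); have := closeE (V p t (K p t)) (q N) N.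
case: (close _) => // dKN _.
have := cauchy_rep_dist N qy.
have := metric_triangle y (alpha (q N)) (alpha (V p t (K p t))).
by rewrite [mdist (alpha (q N)) _]metric_sym; lra.
Qed.

(** With the points [u n] known up to 2^-(k+6), the indices close at precision
    2^-(k+4) differ by less than 3 * 2^-(k+4), which leaves 2^-(k+2) as an error
    bound for entry [k], while all late indices pass the test. *)
Lemma limit_of_names V : prim2 V -> exists2 Phi, prim2 Phi &
  forall p q (u : nat -> Y) (y : Y), approximates (V p) q ->
    (forall n, cauchy_rep (row q n) (u n)) -> u n @[n --> \oo] --> y ->
    exists2 h, cauchy_rep h y &
      forall k, exists t0, forall t, (t0 <= t)%N -> Phi p t k = h k.
Proof.
move=> HV; have [close [chi [Hchi chiE closeE]]] := dist_test Y.
pose W p t k n := V p t (pairing n (k + 6)).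
(* Index [n] is refuted by a later [m] when both entries are decided and the answer is 1, that is,
   far. *)
pose refuted p t k n m := [&& (n <= m)%N, W p t k n != 0%N, W p t k m != 0%N &
  chi p t (pairing (pairing (W p t k m).-1 (W p t k n).-1) (k + 4)) == 1%N].
pose N p t k := find (fun n => ~~ has (refuted p t k n) (iota 0 t)) (iota 0 t).
have HN : prim2 N by rewrite /N /refuted /W; prim_tac.
exists (fun p t k => (W p t k (N p t k)).-1); first by rewrite /W; prim_tac.
move=> p q u y Vq qu /cvg_mdistP uy.
pose w k n := q (pairing n (k + 6)).
have wu k n : mdist (u n) (alpha (w k n)) <= 2 ^- (k + 6).
  exact: (cauchy_rep_dist (k + 6) (qu n)).
pose cl k n m := close (pairing (pairing (w k m) (w k n)) (k + 4)).
have pow6 k : 2 ^- k = 64 * 2 ^- (k + 6) :> R := exp2V_split R k 6.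
have pow4 k : 2 ^- k = 16 * 2 ^- (k + 4) :> R := exp2V_split R k 4.
have clE k n m : if cl k n m
    then mdist (alpha (w k m)) (alpha (w k n)) < 3 * 2 ^- (k + 4)
    else 2 ^- (k + 4) <= mdist (alpha (w k m)) (alpha (w k n)) := closeE _ _ _.
(* [n0 k] is the index on which the guesses will settle: it passes against all later indices, and
   each smaller one fails against some later index. *)
have /choice[n0 n0E] k : exists n, (forall m, (n <= m)%N -> cl k n m) /\
    forall n', (n' < n)%N -> exists2 m, (n' <= m)%N & ~~ cl k n' m.
  pose good n := `[< forall m, (n <= m)%N -> cl k n m >].
  have ex : exists n, good n.
    (* Terms within half of [2 ^- (k + 6)] of [y] have known points less than [3 * 2 ^- (k + 6)]
       apart. This is below [2 ^- (k + 4)], so the answer cannot be far. *)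
    have [|n nP] := uy (2 ^- (k + 6) / 2); first by have := exp2V_gt0 R (k + 6); lra.
    exists n; apply/asboolP => m nm; have := clE k n m; case: (cl k n m) => //.
    have := nP m nm; have := nP n (leqnn n); have := wu k n; have := wu k m.
    have := metric_triangle (alpha (w k m)) (u m) (alpha (w k n)).
    have := metric_triangle (u m) y (alpha (w k n)).
    have := metric_triangle y (u n) (alpha (w k n)).
    rewrite [mdist (u m) y]metric_sym [mdist (alpha (w k m)) (u m)]metric_sym.
    by have := pow4 k; have := pow6 k; have := exp2V_gt0 R (k + 6); lra.
  exists (ex_minn ex); case: ex_minnP => n /asboolP ngood n_min; split=> // n' n'n.
  have [//|no] := pselect (exists2 m, (n' <= m)%N & ~~ cl k n' m); exfalso.
  have /n_min : good n'; last lia.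
  by apply/asboolP => m n'm; apply: contrapT => /negP ncl; apply: no; exists m.
pose h k := w k (n0 k).
(* Through a late [u m'], the error is at most [2 ^- (k + 6) + 3 * 2 ^- (k + 4)], or 13 units of
   [2 ^- (k + 6)], while [2 ^- k.+2] is 16 of them. *)
have hy k : mdist y (alpha (h k)) <= 2 ^- k.+2.
  apply/ler_addgt0Pr => e /uy[m mP]; set m' := maxn m (n0 k).
  have := clE k (n0 k) m'; rewrite (n0E k).1 ?leq_maxr //.
  have := mP m' (leq_maxl _ _); have := wu k m'.
  have := metric_triangle y (u m') (alpha (h k)).
  have := metric_triangle (u m') (alpha (w k m')) (alpha (h k)).
  have := pow4 k; have := pow6 k; have : 2 ^- k = 4 * 2 ^- k.+2 :> R.
    by have := exp2V_split R k 2; rewrite addn2.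
  by have := exp2V_gt0 R (k + 6); rewrite /h; lra.
exists h.
  split=> [k n kn|].
    have := metric_triangle (alpha (h n)) y (alpha (h k)).
    rewrite [mdist _ y]metric_sym; have := hy n; have := hy k.
    have : 2 ^- n.+2 <= 2 ^- k.+2 :> R by apply: exp2V_le.
    have := exp2VS R k; have := exp2VS R k.+1; have := exp2V_gt0 R k.+2.
    lra.
  apply/cvg_mdistP => e /exp2V_lt[m me]; exists m => n mn.
  by apply: le_lt_trans (hy n) (le_lt_trans _ me); apply: exp2V_le; lia.
move=> k; have [t1 t1E] : exists t0, forall t, (t0 <= t)%N ->
    forall n, (n < n0 k)%N -> has (refuted p t k n) (iota 0 t).
  apply: eventually_all => n /(n0E k).2[m nm /negbTE ncl].
  have [t1 t1E] := approximates_eventually (pairing n (k + 6)) Vq.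
  have [t2 t2E] := approximates_eventually (pairing m (k + 6)) Vq.
  have [t3 t3E] := approximates_eventually
    (pairing (pairing (w k m) (w k n)) (k + 4)) (chiE p).
  exists (maxn t1 (maxn t2 (maxn t3 m.+1))) => t tt; apply/hasP; exists m.
    by rewrite mem_iota; lia.
  rewrite /refuted /W t1E ?t2E ?nm /=; [|lia..].
  by rewrite t3E -/(cl k n m) ?ncl //; lia.
have [t2 t2E] := approximates_eventually (pairing (n0 k) (k + 6)) Vq.
exists (maxn t1 (maxn t2 (n0 k).+1)) => t tt.
rewrite (_ : N p t k = n0 k) ?/W ?t2E //; first lia.
apply: find_iota; first lia.
  (* The index [n0 k] is never refuted: decided values are right at every stage, so the answer far
     would contradict the choice of [n0 k]. *)
  apply/hasPn => m _; apply/negP => /and4P[nm Wn Wm].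
  rewrite /W (Vq.1 _ _ Wn) (Vq.1 _ _ Wm) /= => /eqP chi1.
  have := (chiE p).1 t (pairing (pairing (w k m) (w k (n0 k))) (k + 4)).
  by rewrite chi1 => /(_ isT); rewrite -/(cl k (n0 k) m) (n0E k).1.
by move=> n nn; rewrite negbK; apply: t1E => //; lia.
Qed.

End Limits.

Theorem theorem5p3 (R : realType) (X : represented_space)
    (Y : computable_metric_space R) (f : problem X (cauchy_space Y)) :
  limit_computable f <->
  exists g : problem X (seq_space (cauchy_space Y)),
    computable g /\ refines (mcomp (@lim_map R Y) g) f.
Proof.
split=> [[F [M MF] [F1 Ff]]|[g [[G [M M1 MG] [G1 Gg]] [fg lim_g]]]].
- have [V HV VE] := limit_approx M.
  have [a Ha aE] := limit_name_sequence Y HV.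
  (* Different names of [x] may give different sequences, so [g] collects those of all names. The
     condition [mdom f x] ensures that each of them converges to a value of [f]. *)
  pose g : problem X (seq_space (cauchy_space Y)) := fun x =>
    [set u | mdom f x /\ exists2 p, rs_rep p x & u = fun t => cms_alpha Y (a p t)].
  have gP p x u : rs_rep p x -> mdom f x ->
      u = (fun t => cms_alpha Y (a p t)) ->
      exists2 y, f x y & u n @[n --> \oo] --> y.
    move=> px fx ->; have [|q [y [Fq qy [_ [x' px' fy]]]]] := Ff p.
      have [y fy] := fx; exists y; split; last by exists x.
      by move=> x' px'; rewrite (rs_rep_single px' px).
    exists y; first by rewrite (rs_rep_single px px').
    by apply: aE qy; apply: VE; exact: MF.
  (* Row [t] of this name is constantly [a p t]; the stage argument is a dummy, later set to 0. *)
  have Hcode : prim2 (fun p _ i => code (fun n => a p (un1 n)) i).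
    by apply: (@prim_code_of (fun p _ n => a p (un1 n))); rewrite /prim2; prim_tac.
  have [M' M'1 M'E] := prim_prints (prim_comp2 Hcode (prim_const 0) prim_id).
  exists g; split; last first.
    have lim_gx x : mdom f x -> g x `<=` mdom (@lim_map R Y).
      by move=> fx u [_ [p px uE]]; have [y _ uy] := gP p x u px fx uE; exists y.
    split=> [x fx|x fx y [_ [u [_ [p px uE]] uy]]].
      have [p px] := rs_rep_surj x.
      have [y _ uy] := gP p x _ px fx erefl.
      exists y; split; first exact: lim_gx.
      by exists (fun t => cms_alpha Y (a p t)) => //; split=> //; exists p.
    have [y' fy' uy'] := gP p x u px fx uE.
    by rewrite (cvg_unique (@metric_hausdorff R Y) uy uy').
  exists (fun p => [set q | q = fun n => a p (un1 n)]).
    exists M' => // p _ ->; apply: M'E => i.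
    by case: (code _ i).
  split=> [p q q' -> -> //|p [u [pg [x px [fx _]]]]].
  exists (fun n => a p (un1 n)), (fun t => cms_alpha Y (a p t)); split=> //.
    move=> n; rewrite (_ : row _ n = fun=> a p n); first exact: cauchy_rep_const.
    by apply/funext => k; rewrite /row pairingK1.
  by split=> //; exists x => //; split=> //; exists p.
have [V HV VE] := one_way_approx M1.
have [Phi HPhi PhiE] := limit_of_names Y HV.
have [M' M'E] := prim_prints_limit (prim_code_of HPhi).
(* The realizer is the relation of what [M'] produces, a partial function by [produces_inj]. *)
exists (fun p => [set h | produces M' p h]); first by exists M'.
split=> [p q q'|p [y [pf [x px fy]]]]; first exact: produces_inj.
have fx : mdom f x by exists y.
have [z [gx [u gu uz]]] := fg _ fx.
have [|q [v [Gq qv [_ [x' px' gv]]]]] := Gg p.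
  exists u; split; last by exists x.
  by move=> x' px'; rewrite (rs_rep_single px' px); exists u.
move: gv; rewrite (rs_rep_single px' px) => gv.
(* The realizer of [g] may choose another sequence [v] than [u]; it converges as well, since all of
   [g x] lies in the domain of the limit map. *)
have [y' vy'] := gx v gv.
have [h hy' hE] := PhiE p q v y' (VE _ _ (MG _ _ Gq)) qv vy'.
exists h, y'; split=> //.
  (* Digit [i] of a code depends only on the entries up to index [i], and these finitely many settle
     together. *)
  apply: M'E => i; have [|t0 t0E] := @eventually_all (fun k t => Phi p t k = h k) i.+1.
    by move=> k _; exact: hE.
  exists t0 => t /t0E tE; rewrite (@code_ext _ h i) //.
  by case: (code h i).
split=> //; exists x => //; apply: lim_g => //.
by split=> //; exists v.
Qed.
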